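(* Let $G$ be a countable sofic group with sofic approximation $\Sigma=(\sigma_n:G\to\mathrm{Sym}(V_n))_{n\ge1}$. Let $(W_n)_{n\ge1}$ be finite nonempty sets with $|W_n|\to\infty$, and let $\widetilde{\Sigma}=(\widetilde{\sigma}_n:G\to\mathrm{Sym}(V_n\times W_n))_{n\ge1}$ be the sofic approximation to $G$ defined by $\widetilde{\sigma}_n^g=\sigma_n^g\times\mathrm{Id}_{W_n}$. Let $(\mathcal{X}^G,\mu,S,d)$ be a metric $G$-process and let $\mathfrak{P}$ be a family of finite Borel partitions of $\mathcal{X}$ such that (Pi) for every $\delta>0$ there exists $\mathcal{P}\in\mathfrak{P}$ all of whose cells have $d$-diameter less than $\delta$, and (Pii) every cell $C$ of every $\mathcal{P}\in\mathfrak{P}$ satisfies $\mu\{x\in\mathcal{X}^G:x_e\in\partial C\}=0$, where $e$ is the identity of $G$. Then $$\mathrm{h}^{\mathrm{m}}_{\widetilde{\Sigma}}(\mu)=\widetilde{\mathrm{h}}_\Sigma(\mu).$$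
   Context: A sofic approximation to $G$ is a sequence of maps $\sigma_n:G\to\mathrm{Sym}(V_n)$, $g\mapsto\sigma_n^g$, with $V_n$ finite nonempty sets, such that $|\{v\in V_n:\sigma_n^g(\sigma_n^h(v))=\sigma_n^{gh}(v)\}|=(1-o(1))|V_n|$ for all $g,h\in G$ and $|\{v\in V_n:\sigma_n^g(v)\ne v\}|=(1-o(1))|V_n|$ for all $g\in G\setminus\{e\}$. A metric $G$-process $(\mathcal{X}^G,\mu,S,d)$ consists of a standard measurable space $\mathcal{X}$, a compact metric $d$ on $\mathcal{X}$ whose Borel sets are the measurable sets of $\mathcal{X}$, the left coordinate-shift action $S$ of $G$ on $\mathcal{X}^G$ (with the convention $(S^gx)_h=x_{hg}$, compatible with the pullback names below), and an $S$-invariant Borel probability measure $\mu$ on $\mathcal{X}^G$. $\mathrm{Prob}(Y)$ denotes the Borel probability measures on $Y$; $\mathrm{Prob}(\mathcal{X}^G)$ carries the weak$^\ast$ topology coming from the product topology on $\mathcal{X}^G$. The following definitions are given for $\Sigma$ and apply verbatim to $\widetilde{\Sigma}$. For $\mathbf{x}\in\mathcal{X}^{V_n}$ and $v\in V_n$ the pullback name is $\Pi^{\sigma_n}_v(\mathbf{x})=(x_{\sigma_n^g(v)})_{g\in G}\in\mathcal{X}^G$, and the empirical distribution is $P^{\sigma_n}_{\mathbf{x}}=\frac{1}{|V_n|}\sum_{v\in V_n}\delta_{\Pi_v^{\sigma_n}(\mathbf{x})}$. For $U\subseteq\mathrm{Prob}(\mathcal{X}^G)$ let $\Omega(U,\sigma_n)=\{\mathbf{x}\in\mathcal{X}^{V_n}:P^{\sigma_n}_{\mathbf{x}}\in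 U\}$. For $\mu_n\in\mathrm{Prob}(\mathcal{X}^{V_n})$: local weak$^\ast$ convergence $\mu_n\stackrel{\mathrm{lw}\ast}{\longrightarrow}\mu$ over $\Sigma$ means $|\{v\in V_n:(\Pi_v^{\sigma_n})_\ast\mu_n\in U\}|=(1-o(1))|V_n|$ for every weak$^\ast$ neighbourhood $U$ of $\mu$. LE-convergence $\mu_n\stackrel{\mathrm{le}}{\longrightarrow}\mu$ means $\mu_n\stackrel{\mathrm{lw}\ast}{\longrightarrow}\mu$ and $\mu_n(\Omega(U,\sigma_n))\to1$ for every weak$^\ast$ neighbourhood $U$ of $\mu$. LDE convergence $\mu_n\stackrel{\mathrm{lde}}{\longrightarrow}\mu$ means $\mu_n\times\mu_n\stackrel{\mathrm{le}}{\longrightarrow}\mu\times\mu$ over $\Sigma$, where $\mathcal{X}^{V_n}\times\mathcal{X}^{V_n}=(\mathcal{X}\times\mathcal{X})^{V_n}$ and $\mathcal{X}^G\times\mathcal{X}^G=(\mathcal{X}\times\mathcal{X})^G$. The same definitions apply to $\mu_i\in\mathrm{Prob}(\mathcal{X}^{V_{n_i}})$ over a subsequence $(\sigma_{n_i})_{i\ge1}$, $n_1<n_2<\cdots$. On $\mathcal{X}^{V}$, $V$ finite, $d^{(V)}(\mathbf{x},\mathbf{y})=\frac{1}{|V|}\sum_{v\in V}d(x_v,y_v)$. For $\nu\in\mathrm{Prob}(\mathcal{X}^V)$, $\mathrm{cov}_{\varepsilon,\delta}(\nu,d^{(V)})$ is the least number of $\delta$-balls in $d^{(V)}$ whose union has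 $\nu$-measure more than $1-\varepsilon$. The model-measure sofic entropy is $$\mathrm{h}^{\mathrm{m}}_\Sigma(\mu)=\sup\Big\{\sup_{\delta,\varepsilon>0}\limsup_{i\to\infty}\frac{1}{|V_{n_i}|}\log\mathrm{cov}_{\varepsilon,\delta}(\mu_i,d^{(V_{n_i})}):\ n_i\uparrow\infty,\ \mu_i\stackrel{\mathrm{lde}}{\longrightarrow}\mu\ \text{over}\ (\sigma_{n_i})_{i\ge1}\Big\}.$$ Also $$\widetilde{\mathrm{h}}_\Sigma(\mu)=\sup\Big\{\limsup_{i\to\infty}\frac{1}{|V_{n_i}|}\mathrm{H}_{\mu_i}(\mathcal{P}^{V_{n_i}}):\ \mathcal{P}\in\mathfrak{P},\ n_i\uparrow\infty,\ \mu_i\stackrel{\mathrm{lw}\ast}{\longrightarrow}\mu\ \text{over}\ (\sigma_{n_i})_{i\ge1}\Big\},$$ where $\mathcal{P}^{V}$ is the partition of $\mathcal{X}^{V}$ into products of cells of $\mathcal{P}$ and $\mathrm{H}_\nu(\mathcal{R})=-\sum_{C\in\mathcal{R}}\nu(C)\log\nu(C)$. Convention: $\sup\emptyset=-\infty$. *)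

(* Defs.v *)
From HB Require Import structures.
From mathcomp Require Import all_boot all_order all_algebra perm.
From mathcomp Require Import all_classical all_reals all_analysis.

Set Implicit Arguments.
Unset Strict Implicit.
Unset Printing Implicit Defensive.

Import Order.TTheory GRing.Theory Num.Theory.
Import numFieldNormedType.Exports.

Local Open Scope classical_set_scope.
Local Open Scope ring_scope.

(* Countable discrete groups, finite or infinite. *)
#[short(type="countGroupType")]
HB.structure Definition CountGroup := {G of Group G & Countable G}.

HB.mixin Record isInhabited (T : Type) := { inhabited_subproof : inhabited T }.

#[short(type="neFinType")]
HB.structure Definition NonemptyFinite := {T of isInhabited T & Finite T}.

Lemma card_neFin (V : neFinType) : (0 < #|V|)%N.
Proof. by case: (@inhabited_subproof V) => v; apply/card_gt0P; exists v. Qed.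

Lemma prod_inhabited (V W : neFinType) : inhabited (V * W)%type.
Proof.
by case: (@inhabited_subproof V) (@inhabited_subproof W) => v [w]; split.
Qed.

HB.instance Definition _ (V W : neFinType) :=
  isInhabited.Build (V * W)%type (prod_inhabited V W).

HB.mixin Record isCompactSpace T & Topological T := {
  compact_setT : compact [set: T]
}.

(* The library's measures live on pointed types; a space whose powers carry a
   probability measure is nonempty, so asking for a point loses nothing. *)
#[short(type="compactMetricType")]
HB.structure Definition CompactMetric (R : numDomainType) :=
  {X of Metric R X & Pointed X & isCompactSpace X}.

(* [config I X] is X^I with the product topology and its Borel sets. *)
Definition config (I : Type) (X : Type) := I -> X.

HB.instance Definition _ (I : Type) (X : topologicalType) :=
  Topological.copy (config I X) {ptws I -> X}.
HB.instance Definition _ (I : Type) (X : pointedType) :=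
  Pointed.copy (config I X) (I -> X).
HB.instance Definition _ (I : Type) (X : ptopologicalType) :=
  Measurable.copy (config I X) (g_sigma_algebraType (@open (config I X))).

HB.instance Definition _ (X Y : ptopologicalType) := Pointed.on (X * Y)%type.

Lemma open_measurable_config (I : Type) (X : ptopologicalType)
  (A : set (config I X)) : open A -> measurable A.
Proof. by move=> oA; apply: sub_sigma_algebra. Qed.

Lemma continuous_config_measurable (I J : Type) (X Y : ptopologicalType)
  (f : config I X -> config J Y) : continuous f -> measurable_fun setT f.
Proof.
move=> /continuousP cf.
apply: (@measurability _ _ _ _ _ f (@open (config J Y))) => //.
move=> _ [B oB <-]; rewrite setTI; apply: open_measurable_config; exact: cf.
Qed.

Lemma config_continuous (T : topologicalType) (J : Type) (X : topologicalType)
  (f : T -> config J X) : (forall j, continuous (fun t => f t j)) ->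
  continuous f.
Proof.
move=> cf t; pose F : set_system {ptws J -> X} := f x @[x --> t].
have FF : Filter F by exact: fmap_filter.
suff : F --> (f t : {ptws J -> X}) by [].
apply/cvg_sup => j U [_ [[B oB <-] Bft] BU].
have nB : nbhs (f t j) B by exact: open_nbhs_nbhs.
have nfB : nbhs t (fun t' => B (f t' j)) := cf j t _ nB.
suff : nbhs t (f @^-1` U) by [].
by move: nfB; apply: filterS => t' Bt'; exact: BU.
Qed.

Lemma coord_continuous (I : eqType) (X : topologicalType) (i : I) :
  continuous (fun x : config I X => x i).
Proof. exact: (@proj_continuous I (fun=> X) i). Qed.

Section products.
Context {R : realType} {X : compactMetricType R} {I : countType}.

Definition zip_config (xy : config I X * config I X) : config I (X * X) :=
  fun i => (xy.1 i, xy.2 i).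

Lemma config_second_countable : @second_countable (config I X).
Proof.
pose T : pseudoPMetricType R :=
  HB.pack {ptws I -> X} (PseudoMetric.on {ptws I -> X}) (Pointed.on (I -> X)).
apply: (@compact_second_countable R T).
have := @tychonoff I (fun=> X) (fun=> setT) (fun=> compact_setT).
by congr (compact _); apply/seteqP; split.
Qed.

Lemma measurable_zip_config : measurable_fun setT zip_config.
Proof.
apply: (@measurability _ _ _ _ _ zip_config (@open (config I (X * X)))) => //.
move=> _ [U oU <-]; rewrite setTI.
have czip : continuous zip_config.
  apply: config_continuous => i [x y].
  have c1 : t.1 i @[t --> (x, y)] --> x i.
    by apply: (@cvg_comp _ _ _ fst (fun z : config I X => z i) _ (nbhs x));
      [exact: cvg_fst|exact: coord_continuous].
  have c2 : t.2 i @[t --> (x, y)] --> y i.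
    by apply: (@cvg_comp _ _ _ snd (fun z : config I X => z i) _ (nbhs y));
      [exact: cvg_snd|exact: coord_continuous].
  exact: cvg_pair c1 c2.
have [B cB [oB bB]] := config_second_countable.
pose D := [set p : set (config I X) * set (config I X) |
  [/\ B p.1, B p.2 & p.1 `*` p.2 `<=` zip_config @^-1` U]].
have -> : zip_config @^-1` U = \bigcup_(p in D) (p.1 `*` p.2).
  rewrite eqEsubset; split => [[x y] Uxy|xy [p [_ _ pU] /pU]]; last by [].
  have /= : nbhs (x, y) (zip_config @^-1` U).
    by apply: czip; exact: open_nbhs_nbhs.
  move=> [[P Q] /= [/bB[P' [BP' P'x] P'P] /bB[Q' [BQ' Q'y] Q'Q]] PQ].
  exists (P', Q') => //; split => // -[x' y'] /= [px qy].
  by apply: PQ; split => /=; [exact: P'P | exact: Q'Q].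
have cD : countable D.
  apply: (@sub_countable _ _ _ (B `*` B)); last exact: countableX.
  by apply: subset_card_le => p [Bp1 Bp2 _].
rewrite bigcup_set_type; apply: countable_bigcupT_measurable.
  by rewrite (eq_countable (card_setT _)).
move=> [p /set_mem[Bp1 Bp2 _]] /=.
by apply: measurableX; apply: open_measurable_config; exact: oB.
Qed.

HB.instance Definition _ := isMeasurableFun.Build _ _ _ _ zip_config
  measurable_zip_config.

(* The product of P and Q, carried by (X * X)^I through the identification
   of X^I * X^I with (X * X)^I. *)
Definition prod_prob (P Q : probability (config I X) R) :
  probability (config I (X * X)) R := distribution (P \x Q)%E zip_config.

End products.

(* The weak* topology, tested on continuous functions; on a compact space these
   are all bounded. *)
Definition wstar_integrals (R : realType) (I : Type) (X : ptopologicalType)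
    (P : probability (config I X) R) :
    {ptws continuousType (config I X) R -> R} :=
  fun f => \int[P]_y f y.

Definition wstar (R : realType) (I : Type) (X : ptopologicalType) :=
  initial_topology (@wstar_integrals R I X).

(* #|{v in V_n : A_n v}| = (1 - o(1)) #|V_n| *)
Definition asymptotically_all (R : realType) (V : nat -> neFinType)
    (A : forall n, set (V n)) : Prop :=
  (#|[pred v | `[< A n v >]]|%:R / #|V n|%:R : R) @[n --> \oo] --> (1 : R).

Definition sofic_approximation (R : realType) (G : countGroupType)
    (V : nat -> neFinType) (sigma : forall n, G -> {perm V n}) : Prop :=
  (forall g h : G, asymptotically_all R
     (fun n => [set v | sigma n g (sigma n h v) = sigma n (g * h)%g v])) /\
  (forall g : G, g <> 1%g -> asymptotically_all R
     (fun n => [set v | sigma n g v <> v])).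

Section inflation.
Context {G : countGroupType} {V W : neFinType}.

Definition inflate_fun (p : {perm V}) (vw : V * W) : V * W := (p vw.1, vw.2).

Lemma inflate_inj (p : {perm V}) : injective (inflate_fun p).
Proof. by move=> [v w] [v' w'] [/perm_inj -> ->]. Qed.

Definition inflate (s : G -> {perm V}) (g : G) : {perm (V * W)%type} :=
  perm (@inflate_inj (s g)).

End inflation.

Definition shift (G : countGroupType) (X : Type) (g : G) (x : config G X) :
  config G X := fun h => x (h * g)%g.

Definition shift_invariant (R : realType) (G : countGroupType)
    (X : ptopologicalType) (mu : probability (config G X) R) : Prop :=
  forall g (A : set (config G X)), measurable A ->
    mu (shift g @^-1` A) = mu A.

Section pullback.
Context {R : realType} {G : countGroupType} {X : ptopologicalType}.
Context {V : neFinType} (s : G -> {perm V}).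

Definition pullback (v : V) (x : config V X) : config G X :=
  fun g => x (s g v).

Lemma measurable_pullback v : measurable_fun setT (pullback v).
Proof.
apply: continuous_config_measurable; apply: config_continuous => g.
exact: coord_continuous.
Qed.

HB.instance Definition _ v := isMeasurableFun.Build _ _ _ _ (pullback v)
  (measurable_pullback v).

Definition local_law (v : V) (nu : probability (config V X) R) :
  probability (config G X) R := distribution nu (pullback v).

Local Open Scope ereal_scope.

Definition empirical (x : config V X) (A : set (config G X)) : \bar R :=
  (#|V|%:R^-1)%:E * \sum_(v : V) \d_(pullback v x) A.

Section empirical_probability.
Variable x : config V X.

Let empirical0 : empirical x set0 = 0.
Proof. by rewrite /empirical big1 ?mule0// => v _; rewrite measure0. Qed.

Let empirical_ge0 A : 0 <= empirical x A.
Proof.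
by rewrite mule_ge0 ?lee_fin ?invr_ge0 ?sume_ge0.
Qed.

Let empirical_sigma_additive : semi_sigma_additive (empirical x).
Proof.
move=> F mF tF mUF; rewrite /empirical.
under eq_fun.
  move=> n; rewrite -ge0_sume_distrr; last by move=> *; exact: sume_ge0.
  rewrite exchange_big/=; over.
apply: cvgeZl => //; apply: cvg_nnesum => [v _|v _].
  by apply: nearW => n; exact: sume_ge0.
exact: measure_semi_sigma_additive.
Qed.

HB.instance Definition _ := isMeasure.Build _ _ _ (empirical x)
  empirical0 empirical_ge0 empirical_sigma_additive.

Let empirical_setT : empirical x setT = 1.
Proof.
rewrite /empirical (eq_bigr (fun=> 1%:E)) => [|v _]; last by rewrite diracT.
rewrite sumEFin sumr_const -EFinM mulVf// pnatr_eq0 -lt0n.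
exact: card_neFin.
Qed.

HB.instance Definition _ := Measure_isProbability.Build _ _ _ (empirical x)
  empirical_setT.

End empirical_probability.

Definition good_models (U : set (probability (config G X) R)) :
  set (config V X) := [set x | U (empirical x)].

End pullback.

(* Weak* neighbourhoods are taken open, so that [good_models] is Borel. *)
Section convergence.
Context {R : realType} {G : countGroupType} {V : nat -> neFinType}.
Variable s : forall n, G -> {perm V n}.

Definition lw_conv (X : ptopologicalType)
    (mu_ : forall n, probability (config (V n) X) R)
    (mu : probability (config G X) R) : Prop :=
  forall U : set (wstar R G X), open U -> U mu ->
    asymptotically_all R (fun n => [set v | U (local_law (s n) v (mu_ n))]).

Definition le_conv (X : ptopologicalType)
    (mu_ : forall n, probability (config (V n) X) R)
    (mu : probability (config G X) R) : Prop :=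
  lw_conv mu_ mu /\
  forall U : set (wstar R G X), open U -> U mu ->
    mu_ n (good_models (s n) U) @[n --> \oo] --> 1%E.

Definition lde_conv (X : compactMetricType R)
    (mu_ : forall n, probability (config (V n) X) R)
    (mu : probability (config G X) R) : Prop :=
  le_conv (fun n => prod_prob (mu_ n) (mu_ n)) (prod_prob mu mu).

End convergence.

Section entropies.
Context {R : realType} {X : compactMetricType R}.

Definition mean_dist (V : neFinType) (x y : config V X) : R :=
  #|V|%:R^-1 * \sum_(v : V) mdist (x v) (y v).

(* The infimum is over a set of natural numbers, hence is its least element
   (or +oo if there is none). *)
Definition cov (V : neFinType) (eps delta : R)
    (nu : probability (config V X) R) : \bar R :=
  ereal_inf [set (n%:R)%:E | n in [set n : nat |
    exists c : 'I_n -> config V X,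
      ((1 - eps)%:E <
         nu (\bigcup_(i : 'I_n) [set y | (mean_dist (c i) y < delta)%R]))%E]].

Definition shannon d (T : measurableType d) (nu : probability T R)
    (Q : set (set T)) : R :=
  - \sum_(A \in Q) (fine (nu A) * ln (fine (nu A))).

Definition finite_borel_partition (P : set (set X)) : Prop :=
  [/\ finite_set P, P `<=` <<s @open X >> & partition P id setT].

Definition partition_power (V : neFinType) (P : set (set X)) :
    set (set (config V X)) :=
  [set A | exists C : V -> set X,
     (forall v, P (C v)) /\ A = [set x | forall v, C v (x v)]].

Definition diam (A : set X) : \bar R :=
  ereal_sup [set (mdist x y)%:E | x in A & y in A].

Definition boundary (A : set X) : set X := closure A `\` A°.

Context {G : countGroupType} {V : nat -> neFinType}.
Variable s : forall n, G -> {perm V n}.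

(* Strict monotonicity of n_ makes (s (n_ i))_i a subsequence; the supremum of
   the empty set is -oo. *)
Definition model_measure_entropy (mu : probability (config G X) R) : \bar R :=
  ereal_sup [set h | exists (n_ : nat -> nat)
      (mu_ : forall i, probability (config (V (n_ i)) X) R),
    [/\ {homo n_ : i j / (i < j)%N},
        lde_conv (fun i => s (n_ i)) mu_ mu &
        h = ereal_sup [set l | exists delta eps : R,
          [/\ 0 < delta, 0 < eps &
              l = limn_esup (fun i =>
                    (#|V (n_ i)|%:R^-1)%:E * lne (cov eps delta (mu_ i)))%E]]]].

Definition lw_entropy (frakP : set (set (set X)))
    (mu : probability (config G X) R) : \bar R :=
  ereal_sup [set h | exists (P : set (set X)) (n_ : nat -> nat)
      (mu_ : forall i, probability (config (V (n_ i)) X) R),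
    [/\ frakP P, {homo n_ : i j / (i < j)%N},
        lw_conv (fun i => s (n_ i)) mu_ mu &
        h = limn_esup (fun i =>
              (#|V (n_ i)|%:R^-1 * shannon (mu_ i) (partition_power P))%:E)]].

End entropies.

(* Main.v *)
Require Import Defs.
From HB Require Import structures.
From mathcomp Require Import all_boot all_order all_algebra perm.
From mathcomp Require Import all_classical all_reals all_analysis.
From mathcomp Require Import measurable_realfun lra ring.

Set Implicit Arguments.
Unset Strict Implicit.
Unset Printing Implicit Defensive.

Import Order.TTheory GRing.Theory Num.Theory.
Import numFieldNormedType.Exports.

Local Open Scope classical_set_scope.
Local Open Scope ring_scope.

(** Both inequalities come from identifying X^(V x W) with (X^V)^W, on which the
    inflated maps act through the first factor only.

    Upper bound.  Let mu_i converge to mu over the inflated maps in the doubly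
    empirical sense, let K be the covering number of mu_i at scale delta, and
    let P have cells of diameter less than delta.  The names for P of
    probability more than 1/K number fewer than K and their cells lie in balls,
    so they miss a set A of measure at least eps ([subset_of_large_information]).
    Conditioned on A, every name has probability at most 1/(K eps), hence the
    entropy is at least ln (K eps).  Averaging over w the marginals on X^V of
    the conditioned measure gives nu_i on X^V, and Gibbs' inequality bounds that
    entropy by #|W| times the entropy of nu_i ([entropy_average_marginal]).
    The local laws survive the conditioning: convergence of mu_i x mu_i applied
    to (f - c) (x) (f - c), where c is the mean of f, says that the local means
    of f - c over A tend to zero in quadratic mean over the vertices
    ([restricted_deviation_square]).  Thus nu_i is admissible for the entropy on
    the right-hand side ([lde_upper_bound]).

    Lower bound.  Given nu_i converging locally weak* over the original maps, a
    discretization with cells shrinking to points replaces nu_i by a measure of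
    finite support with the same name probabilities ([discretization]), and
    mu_i is its product over W.  Since #|W| tends to infinity, the law of large
    numbers makes mu_i x mu_i converge to mu x mu locally and empirically
    ([product_model_lde]).  It also makes the information content of the name of
    a typical sample close to #|W| times the entropy of nu_i.  As the cells of P
    have null boundary, a typical sample has few coordinates near another cell,
    so two typical samples in one small ball have names at small Hamming
    distance; the names of a ball are too few to matter, and the number of balls
    is at least exponential in the entropy ([product_cov_lower]).

    Measures are handled through expectations of bounded measurable functions;
    weak* statements are turned into statements on the mean over the vertices of
    the deviations of a continuous test function ([lw_convP], [le_convP]). *)

(** * Expectations of bounded measurable functions *)

Section bounded_measurable.
Context {R : realType} {d} {T : measurableType d}.
Implicit Types (f g : T -> R).

(** All integrands below are of this kind, so that integrability is automatic. *)
Definition bddm f := measurable_fun setT f /\ exists M : R, forall x, `|f x| <= M.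

Lemma bddm_cst (c : R) : bddm (fun=> c).
Proof. by split; [exact: measurable_cst | exists `|c|]. Qed.

Lemma bddmD f g : bddm f -> bddm g -> bddm (fun x => f x + g x).
Proof.
move=> [mf [M fM]] [mg [N gN]]; split; first exact: measurable_funD.
by exists (M + N) => x; rewrite (le_trans (ler_normD _ _)) ?lerD.
Qed.

Lemma bddmM f g : bddm f -> bddm g -> bddm (fun x => f x * g x).
Proof.
move=> [mf [M fM]] [mg [N gN]]; split; first exact: measurable_funM.
by exists (M * N) => x; rewrite normrM ler_pM.
Qed.

Lemma bddmZ (a : R) f : bddm f -> bddm (fun x => a * f x).
Proof. by move=> bf; apply: bddmM => //; exact: bddm_cst. Qed.

Lemma bddmN f : bddm f -> bddm (fun x => - f x).
Proof.
by move=> bf; under eq_fun do rewrite -mulN1r; exact: bddmZ.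
Qed.

Lemma bddmB f g : bddm f -> bddm g -> bddm (fun x => f x - g x).
Proof. by move=> bf bg; apply: bddmD => //; exact: bddmN. Qed.

Lemma bddm_norm f : bddm f -> bddm (fun x => `|f x|).
Proof.
move=> [mf [M fM]]; split; first exact: measurableT_comp.
by exists M => x; rewrite normr_id.
Qed.

Lemma bddm_sum (J : Type) (r : seq J) (p : pred J) (F : J -> T -> R) :
  (forall j, bddm (F j)) -> bddm (fun x => \sum_(j <- r | p j) F j x).
Proof.
move=> bF; elim: r => [|j r IH].
  under eq_fun do rewrite big_nil.
  exact: bddm_cst.
under eq_fun do rewrite big_cons.
case: (p j) => //; exact: bddmD.
Qed.

Lemma bddm_indic (A : set T) : measurable A -> bddm (\1_A : T -> R).
Proof.
move=> mA; split; first exact: measurable_indic.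
by exists 1 => x; rewrite indicE; case: (_ \in _); rewrite ?normr0 ?normr1.
Qed.

End bounded_measurable.

Lemma bddm_comp (R : realType) d d' (T : measurableType d)
    (T' : measurableType d') (f : T' -> R) (h : T -> T') :
  bddm f -> measurable_fun setT h -> bddm (f \o h).
Proof.
move=> [mf [M fM]] mh; split; first exact: measurableT_comp.
by exists M => x; exact: fM.
Qed.

Section expectation.
Context {R : realType} {d} {T : measurableType d} (P : probability T R).
Implicit Types (f g : T -> R).

Definition Ex f : R := \int[P]_x f x.

Lemma bddm_integrable f : bddm f -> P.-integrable setT (EFin \o f).
Proof.
move=> [mf [M fM]]; apply: measurable_bounded_integrable => //.
  exact: le_lt_trans (probability_le1 P measurableT) (ltry _).
exists M; split; first exact: num_real.
by move=> x Mx y _; apply: (le_trans (fM y)); exact: ltW.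
Qed.

Lemma Ex_cst c : Ex (fun=> c) = c.
Proof.
rewrite /Ex Rintegral_cst// [X in fine X](_ : _ = 1%E) ?mulr1//.
exact: probability_setT.
Qed.

Lemma ExD f g : bddm f -> bddm g -> Ex (fun x => f x + g x) = Ex f + Ex g.
Proof. by move=> bf bg; rewrite /Ex RintegralD//; exact: bddm_integrable. Qed.

Lemma ExZ a f : bddm f -> Ex (fun x => a * f x) = a * Ex f.
Proof. by move=> bf; rewrite /Ex RintegralZl//; exact: bddm_integrable. Qed.

Lemma ExB f g : bddm f -> bddm g -> Ex (fun x => f x - g x) = Ex f - Ex g.
Proof. by move=> bf bg; rewrite /Ex RintegralB//; exact: bddm_integrable. Qed.

Lemma Ex_sum (J : Type) (r : seq J) (p : pred J) (F : J -> T -> R) :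
  (forall j, bddm (F j)) ->
  Ex (fun x => \sum_(j <- r | p j) F j x) = \sum_(j <- r | p j) Ex (F j).
Proof.
move=> bF; elim: r => [|j r IH].
  by under [in LHS]eq_fun do rewrite big_nil; rewrite Ex_cst big_nil.
under [in LHS]eq_fun do rewrite big_cons.
rewrite big_cons; case: (p j) => //.
by rewrite ExD ?IH//; exact: bddm_sum.
Qed.

Lemma le_Ex f g : bddm f -> bddm g -> (forall x, f x <= g x) -> Ex f <= Ex g.
Proof. by move=> bf bg fg; apply: le_Rintegral => //; exact: bddm_integrable. Qed.

Lemma Ex_ge0 f : (forall x, 0 <= f x) -> 0 <= Ex f.
Proof. by move=> f0; apply: Rintegral_ge0. Qed.

Lemma le_norm_Ex f : bddm f -> `|Ex f| <= Ex (fun x => `|f x|).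
Proof. by move=> bf; apply: le_normr_Rintegral => //; exact: bddm_integrable. Qed.

Lemma Ex_bound f M : bddm f -> (forall x, `|f x| <= M) -> `|Ex f| <= M.
Proof.
move=> bf fM; apply: (le_trans (le_norm_Ex bf)); rewrite -[leRHS]Ex_cst.
by apply: le_Ex => //; [exact: bddm_norm | exact: bddm_cst].
Qed.

Lemma Ex_dist f g M : bddm f -> bddm g -> (forall x, `|f x - g x| <= M) ->
  `|Ex f - Ex g| <= M.
Proof. by move=> bf bg fg; rewrite -ExB//; apply: Ex_bound => //; exact: bddmB. Qed.

Lemma Ex_indic A : measurable A -> Ex (\1_A) = fine (P A).
Proof. by move=> mA; rewrite /Ex /Rintegral integral_indic// setIT. Qed.

End expectation.

Lemma Ex_distribution (R : realType) d d' (T : measurableType d)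
    (T' : measurableType d') (P : probability T R) (h : {mfun T >-> T'})
    (f : T' -> R) : bddm f -> Ex (distribution P h) f = Ex P (f \o h).
Proof.
move=> bf; rewrite /Ex /Rintegral integral_distribution//.
- by apply/measurable_EFinP; case: bf.
- by apply/bddm_integrable; apply: bddm_comp bf _; exact: measurable_funP.
Qed.

Section expectation_product.
Context {R : realType} {d d'} {T : measurableType d} {T' : measurableType d'}.
Variables (P : probability T R) (Q : probability T' R).

Lemma bddm_Ex_pair (f : T * T' -> R) : bddm f ->
  bddm (fun x => Ex Q (fun y => f (x, y))).
Proof.
move=> bf; split; last first.
  case: (bf) => mf [M fM]; exists M => x; apply: Ex_bound => //.
  by apply: (bddm_comp (h := pair x) bf); exact: pair1_measurable.
have := measurable_fubini_F (m1 := P) (m2 := Q) (f := EFin \o f).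
rewrite /fubini_F => H; apply: (@measurableT_comp _ _ _ _ _ _ fine) => //.
by apply: H; exact: bddm_integrable.
Qed.

Lemma Ex_prod (f : T * T' -> R) : bddm f ->
  Ex (P \x Q)%E f = Ex P (fun x => Ex Q (fun y => f (x, y))).
Proof.
move=> bf; rewrite {1}/Ex /Rintegral -integral12_prod_meas1; last first.
  exact: bddm_integrable.
rewrite {1}/Ex /Rintegral; congr fine; apply: eq_integral => x _.
rewrite /fubini_F /= /Ex /Rintegral fineK//.
apply: integrable_fin_num => //; apply: (bddm_integrable Q).
by apply: (bddm_comp (h := pair x) bf); exact: pair1_measurable.
Qed.

End expectation_product.

(** The sum is the integer part of [y]. *)
Lemma count_thresholds (R : realType) (K : nat) (y : R) : 0 <= y <= K%:R ->
  y - 1 <= \sum_(k < K) ((k.+1%:R <= y)%R : nat)%:R <= y.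
Proof.
elim: K => [|K IH] /andP[y0 yK].
  rewrite big_ord0; have -> : y = 0 by apply/eqP; rewrite eq_le y0 yK.
  by rewrite sub0r lexx andbT lerN10.
rewrite big_ord_recr /=; have [yK'|Ky] := leP y K%:R.
  have -> : (K.+1%:R <= y) = false.
    by apply/negbTE; rewrite -ltNge (le_lt_trans yK')// ltr_nat.
  by rewrite addr0; apply: IH; rewrite y0.
rewrite (eq_bigr (fun=> 1)) => [|k _]; last first.
  suff -> : k.+1%:R <= y by [].
  by rewrite (le_trans _ (ltW Ky))// ler_nat.
rewrite sumr_const card_ord; have [Ky'|Ky'] := leP K.+1%:R y.
  move: yK Ky'; rewrite -natr1 /=; lra.
by move: Ky' Ky; rewrite -natr1 /=; lra.
Qed.

Section expectation_unique.
Context {R : realType} {d} {T : measurableType d} (P : probability T R).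
Variable L : (T -> R) -> R.
Hypothesis L_lin : forall f g a, bddm f -> bddm g ->
  L (fun x => f x + a * g x) = L f + a * L g.
Hypothesis L_ge0 : forall f, bddm f -> (forall x, 0 <= f x) -> 0 <= L f.
Hypothesis L_indic : forall A, measurable A -> L (\1_A) = fine (P A).

Let L_cst c : L (fun=> c) = c.
Proof.
have b0 := bddm_cst (T := T) (0 : R).
have L0 : L (fun=> 0) = 0.
  have := L_lin (-1) b0 b0; under eq_fun do rewrite mulr0 addr0.
  by rewrite mulN1r subrr.
have -> : (fun _ : T => c) = (fun x => 0 + c * \1_setT x).
  by apply/funext => x; rewrite add0r indicE in_setT mulr1.
rewrite L_lin//; last exact: bddm_indic.
by rewrite L_indic// L0 add0r (probability_setT P) /= mulr1.
Qed.

Let L_bound f M : bddm f -> (forall x, `|f x| <= M) -> `|L f| <= M.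
Proof.
move=> bf fM; have bM := bddm_cst (T := T) (M : R).
rewrite ler_norml; apply/andP; split.
  have := @L_ge0 (fun x => M + 1 * f x).
  rewrite L_lin// L_cst mul1r => H; rewrite -subr_ge0 opprK addrC; apply: H.
    by apply: bddmD => //; exact: bddmZ.
  by move=> x; have := fM x; rewrite ler_norml mul1r => /andP[]; lra.
have := @L_ge0 (fun x => M + (-1) * f x).
rewrite L_lin// L_cst mulN1r => H; rewrite -subr_ge0; apply: H.
  by apply: bddmD => //; exact: bddmZ.
by move=> x; have := fM x; rewrite ler_norml mulN1r => /andP[]; lra.
Qed.

Let L_steps (K : nat) (A : nat -> set T) (e c : R) :
  (forall k, measurable (A k)) ->
  L (fun x => c + e * \sum_(k < K) \1_(A k) x) =
  Ex P (fun x => c + e * \sum_(k < K) \1_(A k) x).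
Proof.
move=> mA; have bA k : bddm (\1_(A k) : T -> R) by exact: bddm_indic.
have bS n : bddm (fun x => \sum_(k < n) \1_(A k) x : R).
  by apply: (@bddm_sum _ _ _ _ _ _ (fun k : 'I_n => \1_(A k))) => k.
rewrite L_lin//; last exact: bddm_cst.
rewrite ExD//; [|exact: bddm_cst|exact: bddmZ].
rewrite L_cst Ex_cst ExZ//; congr (_ + _ * _).
rewrite (@Ex_sum _ _ _ _ _ _ _ (fun k : 'I_K => \1_(A k)))//.
under [RHS]eq_bigr do rewrite Ex_indic//.
elim: K => [|n IH].
  by rewrite big_ord0; under eq_fun do rewrite big_ord0; exact: L_cst.
rewrite big_ord_recr /= -IH -L_indic//.
have := L_lin 1 (bS n) (bA n); rewrite mul1r => <-.
by congr L; apply/funext => x; rewrite big_ord_recr/= mul1r.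
Qed.

(** A bounded measurable function is uniformly within [e] of a combination of
    indicators of its superlevel sets, on which the two functionals agree. *)
Lemma Ex_unique f : bddm f -> L f = Ex P f.
Proof.
move=> bf; have [mf [M fM]] := bf.
apply/eqP; rewrite -subr_eq0 -normr_le0; apply/ler_addgt0Pl => e2 e20.
rewrite addr0; pose e := e2 / 2; have e0 : 0 < e by rewrite divr_gt0.
pose A k := [set x | - M + k.+1%:R * e <= f x].
have mA k : measurable (A k).
  have := measurable_fun_le measurableT
    (@measurable_cst _ _ T _ setT (- M + k.+1%:R * e)) mf.
  by rewrite setTI.
pose K := (Num.truncn (2 * M / e)).+1.
pose g x := - M + e * \sum_(k < K) \1_(A k) x.
have bg : bddm g.
  apply: bddmD; first exact: bddm_cst.
  by apply: bddmZ; apply: bddm_sum => k; exact: bddm_indic.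
have fg x : `|f x - g x| <= e.
  have /andP[fl fu] : - M <= f x <= M by rewrite -ler_norml.
  pose y := (f x + M) / e.
  have fE : f x = - M + e * y by rewrite /y mulrC divfK ?gt_eqF//; lra.
  have /count_thresholds : 0 <= y <= K%:R.
    rewrite divr_ge0 ?(ltW e0)//=; last by lra.
    apply: (@le_trans _ _ (2 * M / e)).
      by rewrite ler_pM2r ?invr_gt0//; lra.
    by rewrite ltW// truncnS_gt.
  have -> : \sum_(k < K) (((k.+1%:R <= y)%R : nat)%:R : R) = \sum_(k < K) \1_(A k) x.
    apply: eq_bigr => k _; rewrite indicE; congr (nat_of_bool _)%:R.
    have -> : (x \in A k) = (- M + k.+1%:R * e <= f x) by apply/asboolP/idP.
    by rewrite fE lerD2l mulrC ler_pM2l.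
  move=> /andP[sl su]; rewrite {1}fE /g.
  rewrite opprD addrACA subrr add0r -mulrBr normrM gtr0_norm//.
  rewrite -[leRHS]mulr1 ler_pM2l// ler_norml; apply/andP; split; lra.
have -> : L f - Ex P f = (L f - L g) - (Ex P f - Ex P g).
  have -> : L g = Ex P g by exact: L_steps.
  by rewrite opprB addrA subrK.
rewrite (le_trans (ler_normB _ _))// (splitr e2) lerD//; last first.
  exact: Ex_dist.
have := L_lin (-1) bf bg; rewrite mulN1r => <-.
apply: L_bound => [|x]; last by rewrite mulN1r; exact: fg.
by apply: bddmD => //; exact: bddmZ.
Qed.

End expectation_unique.

Section finite_mixture.
Context {R : realType} {d d'} {T : measurableType d} {T' : measurableType d'}.
Variables (P : probability T R) (A : set T) (mA : measurable A).
Variables (J : finType) (a : J -> R) (h : J -> T -> T').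
Hypothesis a0 : forall j, 0 <= a j.
Hypothesis mh : forall j, measurable_fun setT (h j).
Hypothesis a1 : \sum_j a j * fine (P A) = 1.

Let Q (B : set T') : \bar R :=
  (\sum_j (a j)%:E * P (A `&` h j @^-1` B))%E.

Let Q0 : Q set0 = 0%E.
Proof.
by rewrite /Q big1// => j _; rewrite preimage_set0 setI0 measure0 mule0.
Qed.

Let Q_ge0 B : (0 <= Q B)%E.
Proof. by apply: sume_ge0 => j _; rewrite mule_ge0 ?lee_fin. Qed.

Let Q_sigma_additive : semi_sigma_additive Q.
Proof.
move=> F mF tF mUF; rewrite /Q.
under eq_fun do rewrite exchange_big/=.
apply: cvg_nnesum => [j _|j _].
  by apply: nearW => n; apply: sume_ge0 => i _; rewrite mule_ge0 ?lee_fin.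
rewrite [X in X @ _ --> _](_ : _ = fun n =>
    ((a j)%:E * \sum_(0 <= i < n) P (A `&` h j @^-1` F i))%E); last first.
  by apply/funext => n; rewrite ge0_sume_distrr.
apply: cvgeZl => //.
rewrite preimage_bigcup setI_bigcupr.
apply: measure_semi_sigma_additive => [i||].
- by apply: measurableI => //; rewrite -[X in measurable X]setTI; exact: mh.
- apply/trivIsetP => i k _ _ ik; have /trivIsetP := tF => /(_ i k I I ik) Fik.
  apply/seteqP; split => // x [[_ xi] [_ xk]].
  by have : (F i `&` F k) (h j x) by []; rewrite Fik.
- apply: bigcup_measurable => i _.
  by apply: measurableI => //; rewrite -[X in measurable X]setTI; exact: mh.
Qed.

HB.instance Definition _ := isMeasure.Build _ _ _ Q Q0 Q_ge0 Q_sigma_additive.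

Let Q_setT : Q setT = 1%E.
Proof.
rewrite /Q -a1 -sumEFin; apply: eq_bigr => j _.
rewrite preimage_setT setIT EFinM fineK//.
by apply: fin_num_measure.
Qed.

HB.instance Definition _ := Measure_isProbability.Build _ _ _ Q Q_setT.

(** With constant [h j] this gives the measures of finite support; with [h j] the
    restriction to a block of coordinates, averages of conditional marginals. *)
Lemma finite_mixture : exists Q' : probability T' R,
  (forall B, Q' B = (\sum_j (a j)%:E * P (A `&` h j @^-1` B))%E) /\
  (forall f, bddm f ->
     Ex Q' f = \sum_j a j * Ex P (fun x => \1_A x * f (h j x))).
Proof.
exists Q; split => // f bf.
have bA : bddm (\1_A : T -> R) by exact: bddm_indic.
have bh j (g : T' -> R) : bddm g -> bddm (fun x => \1_A x * g (h j x)).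
  by move=> bg; apply: (bddmM bA); exact: (bddm_comp bg (mh j)).
apply/esym; apply: (@Ex_unique _ _ _ _
  (fun g => \sum_j a j * Ex P (fun x => \1_A x * g (h j x)))) => //.
- move=> g k c bg bk; rewrite mulr_sumr -big_split /=; apply: eq_bigr => j _.
  rewrite mulrCA -mulrDr; congr (_ * _).
  rewrite -ExZ; last exact: bh.
  rewrite -ExD; [|exact: bh|by apply: bddmZ; exact: bh].
  by congr Ex; apply/funext => x; rewrite mulrDr mulrCA.
- move=> g bg g0; apply: sumr_ge0 => j _; rewrite mulr_ge0//.
  by apply: Ex_ge0 => x; rewrite mulr_ge0// indicE ler0n.
- move=> B mB.
  have mAB j : measurable (A `&` h j @^-1` B).
    by apply: measurableI => //; rewrite -[X in measurable X]setTI; exact: mh.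
  rewrite [X in fine X](_ : _ =
      (\sum_j a j * fine (P (A `&` h j @^-1` B)))%:E); last first.
    rewrite -sumEFin; apply: eq_bigr => j _.
    by rewrite EFinM fineK//; exact: fin_num_measure.
  apply: eq_bigr => j _.
  congr (_ * _); rewrite -Ex_indic//; congr Ex; apply/funext => x.
  by rewrite !indicE in_setI -natrM mulnb.
Qed.

End finite_mixture.

Lemma finite_support_measure (R : realType) d (T : measurableType d)
    (J : finType) (p : J -> R) (x : J -> T) :
  (forall j, 0 <= p j) -> \sum_j p j = 1 ->
  exists Q : probability T R,
    (forall B, Q B = (\sum_(j | `[< B (x j) >]) p j)%:E) /\
    (forall f, bddm f -> Ex Q f = \sum_j p j * f (x j)).
Proof.
move=> p0 p1.
have [j0 _] : exists j0 : J, True.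
  case: (@pickP J xpredT) => [j _|J0]; first by exists j.
  by move: p1; rewrite big_pred0// => /eqP; rewrite eq_sym oner_eq0.
have [] := @finite_mixture R _ _ T T (\d_(x j0)) setT measurableT J p
  (fun j => cst (x j)) p0 (fun=> measurable_cst _).
  rewrite -p1; apply: eq_bigr => j _.
  rewrite [X in _ * X](_ : _ = 1) ?mulr1//.
  exact: (congr1 fine (probability_setT (\d_(x j0) : probability T R))).
move=> Q [QB Qf]; exists Q; split => [B|f bf].
  rewrite QB -sumEFin [RHS]big_mkcond /=; apply: eq_bigr => j _; rewrite setTI.
  case: asboolP => Bj.
    by rewrite (_ : _ @^-1` _ = setT) ?diracT ?mule1//; apply/seteqP; split.
  rewrite (_ : _ @^-1` _ = set0) ?measure0 ?mule0//.
  by apply/seteqP; split => // y /= By.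
rewrite Qf//; apply: eq_bigr => j _; congr (_ * _).
rewrite -[RHS](@Ex_cst _ _ T (\d_(x j0))); congr Ex; apply/funext => y.
by rewrite indicE in_setT mul1r.
Qed.

(** * Continuous functions on powers of a compact space *)

Section compact_config.
Context {R : realType}.

Lemma compact_config (I : eqType) (X : topologicalType) :
  compact [set: X] -> compact [set: config I X].
Proof.
move=> cX; have := @tychonoff I (fun=> X) (fun=> setT) (fun=> cX).
by congr (compact _); apply/seteqP; split.
Qed.

Lemma compact_setTX (X Y : topologicalType) :
  compact [set: X] -> compact [set: Y] -> compact [set: X * Y].
Proof. by move=> cX cY; rewrite -setXTT; exact: compact_setX. Qed.

Lemma continuous_bddm (I : eqType) (X : ptopologicalType)
    (f : config I X -> R) : compact [set: X] -> continuous f -> bddm f.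
Proof.
move=> cX cf; split.
  apply: (measurability _ (RGenOpens.measurableE R)) => // _ [_ [a [b ->]] <-].
  rewrite setTI; apply: open_measurable_config.
  by move/continuousP : cf; apply; exact: interval_open.
have cfX : compact (f @` setT).
  apply: continuous_compact; first exact: continuous_subspaceT.
  exact: compact_config.
have [M [_ fM]] := compact_bounded cfX.
exists (M + 1) => x; apply: (fM (M + 1)); last by exists x.
by rewrite ltrDl.
Qed.

(** The sup-distance does not define the product topology, so Heine's theorem
    does not apply directly.  Two points where the values of [f] differ by [e]
    differ at some coordinate, and this stays true, with a positive lower bound
    on the distance, near the pair; compactness of the space of pairs makes the
    bound uniform. *)
Lemma uniform_modulus (I : eqType) (X : compactMetricType R)
    (f : config I X -> R) : continuous f -> forall e, 0 < e ->
  exists2 r, 0 < r & forall x y, (forall i, mdist (x i) (y i) < r) ->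
    `|f x - f y| < e.
Proof.
move=> cf e e0.
have cZ : compact [set: config I X * config I X].
  by apply: compact_setTX; exact: compact_config compact_setT.
pose P (r : R) (z : config I X * config I X) :=
  e <= `|f z.1 - f z.2| -> exists i, r < mdist (z.1 i) (z.2 i).
have c12 (z : config I X * config I X) :
    (forall g : config I X -> R, continuous g ->
      g z'.1 @[z' --> z] --> g z.1 /\ g z'.2 @[z' --> z] --> g z.2).
  move=> g cg; split.
    by apply: (@cvg_comp _ _ _ fst g _ (nbhs z.1)); [exact: cvg_fst|exact: cg].
  by apply: (@cvg_comp _ _ _ snd g _ (nbhs z.2)); [exact: cvg_snd|exact: cg].
have r0 : \forall r \near (0 : R)^'+, setT `<=` P r.
  have /compact_near_coveringP := cZ; apply => z _.
  have [fz|fz] := leP e `|f z.1 - f z.2|; last first.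
    have : `|f z'.1 - f z'.2| @[z' --> z] --> `|f z.1 - f z.2|.
      have [h1 h2] := c12 z _ cf; exact: (cvg_norm (cvgB h1 h2)).
    move=> /(_ _ (lt_nbhsl fz)) /= H.
    exists ([set z' | `|f z'.1 - f z'.2| < e], setT) => [|[z' r] [/= + _]].
      by split; [exact: H|exact: filterT].
    by rewrite /P /= ltNge => /negP.
  have [i zi] : exists i, 0 < mdist (z.1 i) (z.2 i).
    apply: contrapT => /forallNP H; move: fz; rewrite (_ : z.1 = z.2).
      by rewrite subrr normr0 leNgt e0.
    apply/funext => i; apply: mdist_positivity; apply/eqP.
    by rewrite eq_le mdist_ge0 andbT leNgt; apply/negP/H.
  set D := mdist _ _ in zi.
  have D4 : 0 < D / 4 by rewrite divr_gt0.
  have n (x : config I X) : \forall x' \near x, mdist (x i) (x' i) < D / 4.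
    have := @Defs.coord_continuous I X i x _ (nbhsx_ballx (x i) _ D4).
    by rewrite ballEmdist.
  exists ([set z' | mdist (z.1 i) (z'.1 i) < D / 4 /\
                    mdist (z.2 i) (z'.2 i) < D / 4], [set r | r < D / 4]).
    split; last exact: nbhs_right_lt.
    by exists ([set x | mdist (z.1 i) (x i) < D / 4],
               [set x | mdist (z.2 i) (x i) < D / 4]) => //; split; exact: n.
  move=> -[z' r] /= [[z1 z2] rD] _; exists i => /=.
  have := metric_triangle (z.1 i) (z'.1 i) (z.2 i).
  have := metric_triangle (z'.1 i) (z'.2 i) (z.2 i).
  rewrite (metric_sym (z'.2 i)) -/D; lra.
have r1 : \forall r \near (0 : R)^'+, setT `<=` P r /\ 0 < r.
  apply: filterI; [exact: r0|exact: nbhs_right_gt].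
have [r [Pr r_gt0]] := @filter_ex _ _ (at_right_proper_filter (0 : R)) _ r1.
exists r => // x y xy; rewrite ltNge; apply/negP => H.
have [i /=] := Pr (x, y) Logic.I H.
by rewrite ltNge (ltW (xy i)).
Qed.

(** Uniformity in the compact variable of the continuity in the other one. *)
Lemma tube (K Y : topologicalType) (F : K * Y -> R) :
  compact [set: K] -> continuous F -> forall y e, 0 < e ->
  \forall y' \near y, forall x, `|F (x, y') - F (x, y)| < e.
Proof.
move=> cK cF y e e0.
suff : \forall y' \near y,
    setT `<=` (fun y' x => `|F (x, y') - F (x, y)| < e) y'.
  by apply: filterS => y' H x; exact: H.
have /compact_near_coveringP := cK; apply => x _.
have e2 : 0 < e / 2 by rewrite divr_gt0.
have := cF (x, y) _ (nbhsx_ballx (F (x, y)) _ e2).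
move=> -[[A B] /= [nA nB] AB].
exists (A, B) => // -[x' y'] /= [Ax' By'].
have /= := AB (x', y') (conj Ax' By').
have /= := AB (x', y) (conj Ax' (nbhs_singleton nB)).
rewrite /ball /= => h1 h2.
rewrite (_ : _ - _ = (F (x, y) - F (x', y)) - (F (x, y) - F (x', y'))); last first.
  by rewrite opprB addrACA addrC addrA addrC; ring.
by rewrite (le_lt_trans (ler_normB _ _))// (splitr e) ltrD.
Qed.

Lemma tube_net (K : topologicalType) (Y : ptopologicalType) (F : K * Y -> R) :
  compact [set: K] -> compact [set: Y] -> continuous F -> forall e, 0 < e ->
  exists s : seq Y, forall y, exists2 y', y' \in s &
    forall x, `|F (x, y) - F (x, y')| < e.
Proof.
move=> cK cY cF e e0.
have cY' : cover_compact [set: Y] by rewrite -compact_cover.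
have [y _|y _|D _ cD] := cY' Y setT
  (fun y => [set y' | forall x, `|F (x, y') - F (x, y)| < e]°).
- exact: open_interior.
- by exists y => //; exact: tube.
- exists (finmap.enum_fset D) => y; have [y' Dy' /interior_subset H] := cD y Logic.I.
  by exists y'.
Qed.

End compact_config.


Section weak_star.
Context {R : realType} {I : countType} {X : ptopologicalType}.
Implicit Types (P mu : probability (config I X) R).

Lemma wstar_open_test (f : config I X -> R) (c e : R) : continuous f ->
  open [set P : wstar R I X | `|Ex P f - c| < e].
Proof.
move=> cf; pose g : continuousType (config I X) R := mkcts cf.
pose A := [set phi : {ptws continuousType (config I X) R -> R} |
  `|phi g - c| < e].
suff oA : open A by exists A.
have /continuousP h := @Defs.coord_continuous (continuousType (config I X) R) R g.
suff oB : open [set x : R | `|x - c| < e] by exact: (h _ oB).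
rewrite (_ : mkset _ = ball c e); first exact: ball_open.
by apply/seteqP; split => x /=; rewrite /ball/= distrC.
Qed.

(** The topology is initial, so finitely many tests define a base. *)
Lemma wstar_nbhs_tests (U : set (wstar R I X)) mu : open U -> U mu ->
  exists (s : seq (continuousType (config I X) R)) (e : R), 0 < e /\
    forall P, (forall f, f \in s -> `|Ex P f - Ex mu f| < e) -> U P.
Proof.
move=> [A oA <-] Amu.
pose B (p : seq (continuousType (config I X) R) * R) :
  set {ptws continuousType (config I X) R -> R} :=
  [set phi | forall f, f \in p.1 -> `|phi f - Ex mu f| < p.2].
pose F := filter_from [set p | 0 < p.2] B.
have FF : Filter F.
  apply: filter_from_filter; first by exists ([::], 1); exact: ltr01.
  move=> [s e] [s' e'] /= e0 e'0; exists (s ++ s', Num.min e e') => /=.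
    by rewrite lt_min e0.
  move=> phi /= H; split => f fs; have := H f; rewrite mem_cat fs ?orbT/=.
    by move=> /(_ isT); rewrite lt_min => /andP[].
  by move=> /(_ isT); rewrite lt_min => /andP[].
have : F --> (@wstar_integrals R I X mu :
    {ptws continuousType (config I X) R -> R}).
  apply/cvg_sup => f C [_ [[D oD <-] Df] DC].
  have nD : nbhs (Ex mu f) D by exact: open_nbhs_nbhs.
  have /nbhs_ballP [e /= e0 eD] := nD.
  exists ([:: f], e) => //= phi H; apply: DC; apply: eD.
  by rewrite /ball/= distrC; apply: H; rewrite inE.
move=> /(_ A (open_nbhs_nbhs (conj oA Amu))) [[s e] /= e0 sA].
by exists s, e; split => // P H; apply: sA.
Qed.

End weak_star.

(** * Convergence through test functions *)

Section vanishing.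
Context {R : realType}.
Implicit Types u w : nat -> R.

(** Used for nonnegative sequences, for which it is convergence to zero. *)
Definition vanishing u := forall e, 0 < e -> \forall n \near \oo, u n <= e.

Lemma vanishing_le u w : (forall n, u n <= w n) -> vanishing w -> vanishing u.
Proof.
by move=> uw vw e e0; apply: filterS (vw e e0) => n; exact: le_trans.
Qed.

Lemma vanishingD u w : vanishing u -> vanishing w ->
  vanishing (fun n => u n + w n).
Proof.
move=> vu vw e e0; have e2 : 0 < e / 2 by rewrite divr_gt0.
by apply: filterS2 (vu _ e2) (vw _ e2) => n un wn; rewrite (splitr e) lerD.
Qed.

Lemma vanishingZ (c : R) u : 0 <= c -> vanishing u ->
  vanishing (fun n => c * u n).
Proof.
rewrite le_eqVlt => /predU1P[<- _ e e0|c0 vu e e0].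
  by apply: nearW => n; rewrite mul0r ltW.
have ec : 0 < e / c by rewrite divr_gt0.
by apply: filterS (vu _ ec) => n; rewrite ler_pdivlMr// mulrC.
Qed.

Lemma vanishing0 : vanishing (fun=> 0).
Proof. by move=> e e0; apply: nearW => n; exact: ltW. Qed.

Lemma vanishing_sum (T : Type) (r : seq T) (F : T -> nat -> R) :
  (forall i, vanishing (F i)) -> vanishing (fun n => \sum_(i <- r) F i n).
Proof.
move=> vF; elim: r => [|i r IH].
  by under eq_fun do rewrite big_nil; exact: vanishing0.
by under eq_fun do rewrite big_cons; exact: vanishingD.
Qed.

(** Bounds of this form come from cutting at the level [t], as in Markov's
    inequality: the error below the level is [t], the rest is rare. *)
Lemma vanishing_split u (w : R -> nat -> R) (C : R -> R) :
  (forall t, 0 < t -> 0 <= C t /\ vanishing (w t)) ->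
  (forall t n, 0 < t -> u n <= t + C t * w t n) -> vanishing u.
Proof.
move=> vw uw e e0; have e2 : 0 < e / 2 by rewrite divr_gt0.
have [C0 v] := vw _ e2.
apply: filterS ((vanishingZ C0 v) _ e2) => n H.
by rewrite (le_trans (uw _ n e2))// [leRHS]splitr lerD2l.
Qed.

End vanishing.

Section average.
Context {R : realType} {V : neFinType}.
Implicit Types g h : V -> R.

Definition avg g : R := #|V|%:R^-1 * \sum_v g v.

Lemma card_gt0R : 0 < #|V|%:R :> R. Proof. by rewrite ltr0n card_neFin. Qed.

Lemma avg_cst c : avg (fun=> c) = c.
Proof.
rewrite /avg sumr_const -[c *+ _]mulr_natl mulrA mulVf ?mul1r//.
by rewrite gt_eqF// card_gt0R.
Qed.

Lemma avgD g h : avg (fun v => g v + h v) = avg g + avg h.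
Proof. by rewrite /avg big_split mulrDr. Qed.

Lemma avgZ c g : avg (fun v => c * g v) = c * avg g.
Proof. by rewrite /avg -mulr_sumr mulrCA. Qed.

Lemma avgB g h : avg (fun v => g v - h v) = avg g - avg h.
Proof. by rewrite /avg sumrB mulrBr. Qed.

Lemma avg_sum (T : Type) (r : seq T) (F : T -> V -> R) :
  avg (fun v => \sum_(i <- r) F i v) = \sum_(i <- r) avg (F i).
Proof. by rewrite /avg exchange_big mulr_sumr. Qed.

Lemma le_avg g h : (forall v, g v <= h v) -> avg g <= avg h.
Proof. by move=> gh; rewrite ler_wpM2l ?invr_ge0// ler_sum. Qed.

Lemma avg_ge0 g : (forall v, 0 <= g v) -> 0 <= avg g.
Proof. by move=> g0; rewrite mulr_ge0 ?invr_ge0// sumr_ge0. Qed.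

Lemma le_norm_avg g : `|avg g| <= avg (fun v => `|g v|).
Proof.
rewrite normrM ger0_norm ?invr_ge0//.
by rewrite ler_wpM2l ?invr_ge0// ler_norm_sum.
Qed.

Lemma avg_bound g M : (forall v, `|g v| <= M) -> `|avg g| <= M.
Proof.
by move=> gM; rewrite (le_trans (le_norm_avg g))// -[leRHS]avg_cst le_avg.
Qed.

Lemma avg_card (p : pred V) : avg (fun v => (p v)%:R) = #|p|%:R / #|V|%:R.
Proof.
rewrite /avg mulrC -natr_sum; congr (_%:R / _).
rewrite -sum1_card [in RHS]big_mkcond /=.
by apply: eq_bigr => v _; rewrite unfold_in; case: (p v).
Qed.

End average.

Lemma asymptotically_allP (R : realType) (V : nat -> neFinType)
    (A : forall n, set (V n)) :
  asymptotically_all R A <->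
  vanishing (fun n => avg (fun v => (~~ `[< A n v >])%:R) : R).
Proof.
rewrite /asymptotically_all.
have E n : avg (fun v => (~~ `[< A n v >])%:R) =
    1 - #|[pred v | `[< A n v >]]|%:R / #|V n|%:R :> R.
  apply/eqP; rewrite eq_sym subr_eq -avg_card -avgD; apply/eqP.
  rewrite -[LHS](@avg_cst R (V n)); congr avg; apply/funext => v /=.
  by case: asboolP => _ /=; rewrite ?add0r ?addr0.
split=> [cA e e0|vA].
  move/cvgrPdist_le : cA => /(_ e e0); apply: filterS => n.
  by rewrite E; apply: le_trans; exact: ler_norm.
apply/cvgrPdist_le => e e0; apply: filterS (vA e e0) => n.
rewrite -E => H; rewrite ger0_norm//.
by apply: avg_ge0 => v; rewrite ler0n.
Qed.

Section convergence_tests.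
Context {R : realType} {G : countGroupType} {X : ptopologicalType}.
Hypothesis cX : compact [set: X].

Lemma continuous_pullback (V : neFinType) (s : G -> {perm V}) v :
  continuous (pullback s v : config V X -> config G X).
Proof. by apply: config_continuous => g; exact: Defs.coord_continuous. Qed.

Lemma continuous_config_pullback (V : neFinType) (s : G -> {perm V}) v
    (f : config G X -> R) : continuous f ->
  continuous (fun x : config V X => f (pullback s v x)).
Proof.
move=> cf x; apply: (@continuous_comp _ _ _ (pullback s v) f).
  exact: continuous_pullback.
exact: cf.
Qed.

Lemma bddm_pullback (V : neFinType) (s : G -> {perm V}) v
    (f : config G X -> R) : continuous f ->
  bddm (fun x : config V X => f (pullback s v x)).
Proof.
move=> cf; apply: continuous_bddm => //.
exact: continuous_config_pullback.
Qed.

Lemma Ex_local_law (V : neFinType) (s : G -> {perm V}) v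
    (nu : probability (config V X) R) (f : config G X -> R) : continuous f ->
  Ex (local_law s v nu) f = Ex nu (fun x => f (pullback s v x)).
Proof. by move=> cf; apply: Ex_distribution; exact: continuous_bddm. Qed.

Lemma Ex_empirical (V : neFinType) (s : G -> {perm V}) (x : config V X)
    (f : config G X -> R) : continuous f ->
  Ex (empirical s x) f = avg (fun v => f (pullback s v x)).
Proof.
move=> cf; apply/esym.
apply: (@Ex_unique _ _ _ (empirical s x)
  (fun g => avg (fun v => g (pullback s v x)))).
- by move=> g h a _ _; rewrite avgD avgZ.
- by move=> g _ g0; exact: avg_ge0.
- move=> A mA; rewrite /= /empirical /avg.
  under [in RHS]eq_bigr do rewrite diracE.
  by rewrite sumEFin -EFinM /=; under [in LHS]eq_bigr do rewrite indicE.
- exact: continuous_bddm.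
Qed.

Lemma continuous_avg (V : neFinType) (T : topologicalType) (F : V -> T -> R) :
  (forall v, continuous (F v)) -> continuous (fun x => avg (fun v => F v x)).
Proof.
move=> cF x; rewrite /avg; apply: cvgM; first exact: cvg_cst.
elim: (index_enum V) => [|v r IH].
  by under eq_fun do rewrite big_nil; rewrite big_nil; exact: cvg_cst.
under eq_fun do rewrite big_cons; rewrite big_cons.
by apply: cvgD; [exact: cF|exact: IH].
Qed.

(** The empirical distribution depends continuously on the configuration. *)
Lemma open_good_models (V : neFinType) (s : G -> {perm V})
    (U : set (wstar R G X)) : open U -> open (@good_models R G X V s U).
Proof.
move=> oU; pose h (x : config V X) : wstar R G X := empirical s x.
suff ch : continuous h by move/continuousP : ch; exact.
apply: continuous_comp_initial.
apply: (@config_continuous _ (continuousType (config G X) R) R) => f.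
rewrite (_ : (fun _ => _) =
    (fun x => avg (fun v => f (pullback s v x)))); last first.
  by apply/funext => x; apply: Ex_empirical; exact: cts_fun.
apply: continuous_avg => v; apply: continuous_config_pullback.
exact: cts_fun.
Qed.

Variables (V : nat -> neFinType) (s : forall n, G -> {perm V n}).
Variables (nu : forall n, probability (config (V n) X) R).
Variable mu : probability (config G X) R.

Definition local_deviation (f : config G X -> R) n : R :=
  avg (fun v => `|Ex (nu n) (fun x => f (pullback (s n) v x)) - Ex mu f|).

Definition empirical_deviation (f : config G X -> R) n : R :=
  Ex (nu n) (fun x => `|avg (fun v => f (pullback (s n) v x)) - Ex mu f|).

(** Deviations are bounded by twice the bound of the test function, so smallness
    at most vertices is smallness of the mean; conversely the vertices that fail
    a neighbourhood fail one of finitely many tests, and Markov applies. *)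
Lemma lw_convP : lw_conv s nu mu <->
  forall f, continuous f -> vanishing (local_deviation f).
Proof.
split=> [H f cf|H U oU Umu].
- have [_ [M fM]] := continuous_bddm cX cf.
  have M0 : 0 <= M by exact: le_trans (fM point).
  apply: (@vanishing_split _ _ (fun t n => avg (fun v =>
    (~~ `[< `|Ex (local_law (s n) v (nu n)) f - Ex mu f| < t >])%:R))
    (fun=> M + M)) => [t t0|t n t0].
    split; first exact: addr_ge0.
    apply/(@asymptotically_allP R V (fun n v =>
      `|Ex (local_law (s n) v (nu n)) f - Ex mu f| < t)).
    apply: (H [set P | `|Ex P f - Ex mu f| < t]) => /=.
      exact: wstar_open_test.
    by rewrite subrr normr0.
  rewrite -[X in X + _](@avg_cst R (V n)) -avgZ -avgD; apply: le_avg => v.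
  rewrite Ex_local_law//; case: asboolP => /= [/ltW|_]; first by rewrite mulr0 addr0.
  rewrite mulr1; apply: (@le_trans _ _ (M + M)); last by rewrite lerDr ltW.
  apply: (le_trans (ler_normB _ _)).
  by rewrite lerD//; apply: Ex_bound => //;
    [exact: bddm_pullback|exact: continuous_bddm].
- have [fs [e [e0 He]]] := wstar_nbhs_tests oU Umu.
  apply/asymptotically_allP.
  apply: (@vanishing_le _ _ (fun n =>
    e^-1 * \sum_(f <- fs) local_deviation f n)) => [n|]; last first.
    apply: vanishingZ; first by rewrite invr_ge0 ltW.
    by apply: vanishing_sum => f; apply: H; exact: cts_fun.
  rewrite -avg_sum -avgZ; apply: le_avg => v.
  have S0 (fs' : seq (continuousType (config G X) R)) : 0 <= e^-1 * \sum_(f <- fs')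
     `|Ex (nu n) (fun x => f (pullback (s n) v x)) - Ex mu f|.
    by apply: mulr_ge0; [rewrite invr_ge0 ltW|exact: sumr_ge0].
  case: asboolP => //= Uv.
  have [f ffs fe] : exists2 f, f \in fs &
      e <= `|Ex (nu n) (fun x => f (pullback (s n) v x)) - Ex mu f|.
    apply: contrapT => H'; apply: Uv; apply: He => f ffs.
    rewrite Ex_local_law; last exact: cts_fun.
    by rewrite ltNge; apply/negP => ?; apply: H'; exists f.
  rewrite ler_pdivlMl// mulr1 (le_trans fe)//.
  by rewrite (big_rem f)//= lerDl sumr_ge0.
Qed.

(** The same argument, with [nu n] in place of the uniform measure on vertices. *)
Lemma le_convP : le_conv s nu mu <-> forall f, continuous f ->
  vanishing (local_deviation f) /\ vanishing (empirical_deviation f).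
Proof.
have bavg (f : config G X -> R) n : continuous f ->
    bddm (fun x => `|avg (fun v => f (pullback (s n) v x)) - Ex mu f|).
  move=> cf; apply: bddm_norm; apply: bddmB; last exact: bddm_cst.
  by apply: bddmZ; apply: bddm_sum => v; exact: bddm_pullback.
split=> [[/lw_convP Hlw H] f cf|H].
- split; first exact: Hlw.
  have [_ [M fM]] := continuous_bddm cX cf.
  have M0 : 0 <= M by exact: le_trans (fM point).
  pose U t : set (wstar R G X) := [set P | `|Ex P f - Ex mu f| < t].
  have oU t : open (U t) by exact: wstar_open_test.
  apply: (@vanishing_split _ _ (fun t n =>
    1 - fine (nu n (good_models (s n) (U t)))) (fun=> M + M)) => [t t0|t n t0].
    split; first exact: addr_ge0.
    have Umu : U t mu by rewrite /U/= subrr normr0.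
    move=> e e0.
    have /fine_cvgP[_] := H _ (oU t) Umu.
    move=> /cvgrPdist_le /(_ e e0); apply: filterS => n.
    by apply: le_trans; exact: ler_norm.
  have mg : measurable (good_models (s n) (U t)).
    by apply: open_measurable_config; exact: open_good_models.
  rewrite -Ex_indic// -[X in X - _](Ex_cst (nu n)) -ExB;
    [|exact: bddm_cst|exact: bddm_indic].
  have b1 : bddm (fun x => 1 - \1_(good_models (s n) (U t)) x : R).
    by apply: bddmB; [exact: bddm_cst|exact: bddm_indic].
  rewrite -ExZ// -[X in X + _](Ex_cst (nu n)) -ExD//;
    [|exact: bddm_cst|exact: bddmZ].
  apply: le_Ex; first exact: bavg.
    by apply: bddmD; [exact: bddm_cst|exact: bddmZ].
  move=> x; rewrite indicE; case: (boolP (x \in _)).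
    rewrite inE /good_models /U /= Ex_empirical// => /ltW.
    by rewrite subrr mulr0 addr0.
  move=> _; rewrite subr0 mulr1.
  apply: (@le_trans _ _ (M + M)); last by rewrite lerDr ltW.
  apply: (le_trans (ler_normB _ _)).
  rewrite lerD//; first by apply: avg_bound => v.
  by apply: Ex_bound => //; exact: continuous_bddm.
- split; first by apply/lw_convP => f cf; case: (H f cf).
  move=> U oU Umu; have [fs [e [e0 He]]] := wstar_nbhs_tests oU Umu.
  have mg n : measurable (good_models (s n) U).
    by apply: open_measurable_config; exact: open_good_models.
  have v : vanishing (fun n => e^-1 * \sum_(f <- fs) empirical_deviation f n).
    apply: vanishingZ; first by rewrite invr_ge0 ltW.
    by apply: vanishing_sum => f; case: (H f (@cts_fun _ _ f)).
  apply/fine_cvgP; split; first by apply: nearW => n; exact: fin_num_measure.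
  apply/cvgrPdist_le => t t0; apply: filterS (v t t0) => n; apply: le_trans => /=.
  rewrite ger0_norm; last first.
    rewrite subr_ge0 -lee_fin fineK; last exact: (fin_num_measure _ _ (mg n)).
    exact: (probability_le1 (nu n) (mg n)).
  rewrite -Ex_indic; last exact: mg.
  rewrite -[X in X - _](Ex_cst (nu n)) -ExB;
    [|exact: bddm_cst|exact: bddm_indic].
  have bfs (f : continuousType (config G X) R) : bddm (fun x =>
      `|avg (fun v => f (pullback (s n) v x)) - Ex mu f|).
    by apply: bavg; exact: cts_fun.
  rewrite /empirical_deviation -Ex_sum// -ExZ; last exact: bddm_sum.
  apply: le_Ex.
  + by apply: bddmB; [exact: bddm_cst|exact: bddm_indic].
  + by apply: bddmZ; exact: bddm_sum.
  move=> x; rewrite indicE; case: (boolP (x \in _)) => xg.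
    by rewrite subrr; apply: mulr_ge0; [rewrite invr_ge0 ltW|exact: sumr_ge0].
  rewrite subr0 ler_pdivlMl// mulr1.
  have [f ffs fe] : exists2 f, f \in fs &
      e <= `|avg (fun v => f (pullback (s n) v x)) - Ex mu f|.
    apply: contrapT => H'; move/negP : xg; apply; rewrite inE.
    apply: He => f ffs.
    rewrite Ex_empirical; last exact: cts_fun.
    by rewrite ltNge; apply/negP => ?; apply: H'; exists f.
  by rewrite (le_trans fe)// (big_rem f)//= lerDl sumr_ge0.
Qed.

End convergence_tests.

(** * Product laws *)

Section product_law.
Context {R : realType} {X : compactMetricType R}.

Lemma compact_pair : compact [set: X * X].
Proof. by apply: compact_setTX; exact: compact_setT. Qed.

Lemma continuous_zip_config (I : countType) :
  continuous (zip_config : config I X * config I X -> config I (X * X)).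
Proof.
apply: config_continuous => i [x y].
have c1 : t.1 i @[t --> (x, y)] --> x i.
  by apply: (@cvg_comp _ _ _ fst (fun z : config I X => z i) _ (nbhs x));
    [exact: cvg_fst|exact: Defs.coord_continuous].
have c2 : t.2 i @[t --> (x, y)] --> y i.
  by apply: (@cvg_comp _ _ _ snd (fun z : config I X => z i) _ (nbhs y));
    [exact: cvg_snd|exact: Defs.coord_continuous].
exact: cvg_pair c1 c2.
Qed.

Lemma continuous_section2 (Y Z T : topologicalType) (F : Y * Z -> T) (y : Y) :
  continuous F -> continuous (fun z => F (y, z)).
Proof.
move=> cF z; apply: (@continuous_comp _ _ _ (pair y) F); last exact: cF.
by apply: cvg_pair; [exact: cvg_cst|exact: cvg_id].
Qed.

Lemma bddm_zip (I : countType) (f : config I (X * X) -> R) : continuous f ->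
  bddm (f \o (zip_config : config I X * config I X -> _)).
Proof.
move=> cf; apply: bddm_comp; last exact: measurable_zip_config.
by apply: continuous_bddm => //; exact: compact_pair.
Qed.

Lemma Ex_prod_prob (I : countType) (P Q : probability (config I X) R)
    (f : config I (X * X) -> R) : continuous f ->
  Ex (prod_prob P Q) f = Ex P (fun x => Ex Q (fun y => f (zip_config (x, y)))).
Proof.
move=> cf; rewrite /prod_prob Ex_distribution; last first.
  by apply: continuous_bddm => //; exact: compact_pair.
by rewrite Ex_prod//; exact: bddm_zip.
Qed.

(** By the tube lemma, nearby sections are uniformly close. *)
Lemma continuous_Ex_section (I : countType) (Y : topologicalType)
    (mu : probability (config I X) R) (F : Y * config I X -> R) :
  continuous F -> continuous (fun y => Ex mu (fun x => F (y, x))).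
Proof.
move=> cF y; apply/cvgrPdist_le => e e0.
pose F' (z : config I X * Y) := F (z.2, z.1).
have cF' : continuous F'.
  move=> z; apply: (@continuous_comp _ _ _ (fun z => (z.2, z.1)) F).
    exact: swap_continuous.
  exact: cF.
have := tube (compact_config compact_setT) cF' y e0.
apply: filterS => y' H; rewrite distrC; apply: Ex_dist => [||x].
- by apply: (continuous_bddm compact_setT); exact: continuous_section2.
- by apply: (continuous_bddm compact_setT); exact: continuous_section2.
- exact: ltW (H x).
Qed.

End product_law.

Section product_convergence.
Context {R : realType} {X : compactMetricType R} {G : countGroupType}.
Variables (V : nat -> neFinType) (s : forall n, G -> {perm V n}).
Variables (nu : forall n, probability (config (V n) X) R).
Variable mu : probability (config G X) R.

(** By compactness, finitely many sections [F (x', _)] approximate all the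
    sections of [F] uniformly; integrating one variable at a time then reduces
    to local convergence along these sections and along the partial average. *)
Lemma local_deviation_prod :
  (forall f, continuous f -> vanishing (local_deviation s nu mu f)) ->
  forall F, continuous F -> vanishing
    (local_deviation s (fun n => prod_prob (nu n) (nu n)) (prod_prob mu mu) F).
Proof.
move=> H F cF e e0; pose F' := F \o (zip_config : config G X * config G X -> _).
have cF' : continuous F'.
  by move=> z; apply: continuous_comp; [exact: continuous_zip_config|exact: cF].
have cX : compact [set: X] by exact: compact_setT.
have cK : compact [set: config G X] by exact: compact_config.
pose Fs (z : config G X * config G X) := F' (z.2, z.1).
have cFs : continuous Fs.
  move=> z; apply: (@continuous_comp _ _ _ (fun z => (z.2, z.1)) F').
    exact: swap_continuous.
  exact: cF'.
have e4 : 0 < e / 4 by rewrite divr_gt0.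
have [xs xsP] := tube_net cK cK cFs e4.
pose Hx x := Ex mu (fun y => F' (x, y)).
have cH : continuous Hx by exact: continuous_Ex_section.
have cF'x x : continuous (fun y => F' (x, y)) by exact: continuous_section2.
have v : vanishing (fun n =>
    \sum_(x <- xs) local_deviation s nu mu (fun y => F' (x, y)) n +
    local_deviation s nu mu Hx n).
  apply: vanishingD; last exact: H.
  by apply: vanishing_sum => x; exact: H.
have e2 : 0 < e / 2 by rewrite divr_gt0.
apply: filterS (v _ e2) => n Hn.
suff : local_deviation s (fun n => prod_prob (nu n) (nu n)) (prod_prob mu mu) F n
    <= e / 2 + (\sum_(x <- xs) local_deviation s nu mu (fun y => F' (x, y)) n +
        local_deviation s nu mu Hx n).
  by move=> /le_trans; apply; rewrite [leRHS]splitr lerD2l.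
rewrite -[X in X + _](@avg_cst R (V n)) -avg_sum -!avgD; apply: le_avg => w.
pose p : config (V n) X -> config G X := pullback (s n) w.
have cp : continuous p by exact: continuous_pullback.
rewrite Ex_prod_prob; last first.
  by apply: continuous_config_pullback.
rewrite Ex_prod_prob//.
have -> : Ex (nu n) (fun x => Ex (nu n) (fun y =>
    F (pullback (s n) w (zip_config (X := X) (x, y))))) =
    Ex (nu n) (fun x => Ex (nu n) (fun y => F' (p x, p y))) by [].
have -> : Ex mu (fun x => Ex mu (fun y => F (zip_config (X := X) (x, y)))) =
  Ex mu Hx by [].
pose S := \sum_(x <- xs) `|Ex (nu n) (fun y => F' (x, p y)) -
  Ex mu (fun y => F' (x, y))|.
have cg x : continuous (fun y => F' (x, p y)).
  exact: (continuous_config_pullback (cF'x x)).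
have inner x : `|Ex (nu n) (fun y => F' (p x, p y)) - Hx (p x)| <= e / 2 + S.
  have [x' x'xs x'P] := xsP (p x).
  have le4 (y : config G X) : `|F' (p x, y) - F' (x', y)| <= e / 4.
    exact: ltW (x'P y).
  have b1 : bddm (fun y => F' (p x, p y)) by exact: continuous_bddm (cg _).
  have b2 : bddm (fun y => F' (x', p y)) by exact: continuous_bddm (cg _).
  have b3 z : bddm (fun y => F' (z, y)) by exact: continuous_bddm (cF'x z).
  have h1 := Ex_dist (nu n) b1 b2 (fun y => le4 (p y)).
  have h2 := Ex_dist mu (b3 (p x)) (b3 x') le4.
  have h3 : `|Ex (nu n) (fun y => F' (x', p y)) - Ex mu (fun y => F' (x', y))|
      <= S by rewrite /S (big_rem x')//= lerDl sumr_ge0.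
  rewrite /Hx; move: h1 h2 h3; rewrite !ler_norml.
  by move=> /andP[? ?] /andP[? ?] /andP[? ?]; apply/andP; split; lra.
rewrite (_ : _ - _ = (Ex (nu n) (fun x => Ex (nu n) (fun y => F' (p x, p y))) -
  Ex (nu n) (fun x => Hx (p x))) + (Ex (nu n) (fun x => Hx (p x)) - Ex mu Hx));
  last by rewrite addrA subrK.
apply: (le_trans (ler_normD _ _)); rewrite addrA lerD2r.
apply: Ex_dist inner.
  have cFp : continuous (fun z : config (V n) X * config (V n) X =>
      F' (p z.1, p z.2)).
    move=> z; apply: (@continuous_comp _ _ _ (fun z => (p z.1, p z.2)) F').
      have c1 : p z'.1 @[z' --> z] --> p z.1.
        by apply: (@cvg_comp _ _ _ fst p _ (nbhs z.1)); [exact: cvg_fst|exact: cp].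
      have c2 : p z'.2 @[z' --> z] --> p z.2.
        by apply: (@cvg_comp _ _ _ snd p _ (nbhs z.2)); [exact: cvg_snd|exact: cp].
      exact: (cvg_pair c1 c2).
    exact: cF'.
  by apply: continuous_bddm => //; exact: (continuous_Ex_section cFp).
by apply: continuous_bddm => //; exact: (continuous_config_pullback cH).
Qed.

(** The tensor square [(f - c) (x) (f - c)], with [c] the mean of [f], has mean
    zero for [mu * mu]; integrating its empirical averages over [A * A] gives
    the mean square of the local deviations of the restrictions to [A]. *)
Lemma restricted_deviation_square (A : forall n, set (config (V n) X))
    (f : config G X -> R) :
  (forall n, measurable (A n)) -> continuous f ->
  lde_conv s nu mu ->
  vanishing (fun n => avg (fun v =>
    (Ex (nu n) (fun x => \1_(A n) x * (f (pullback (s n) v x) - Ex mu f))) ^+ 2)).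
Proof.
move=> mA cf /(le_convP compact_pair) H; set c := Ex mu f.
have cX : compact [set: X] by exact: compact_setT.
pose F (z : config G (X * X)) := (f (fst \o z) - c) * (f (snd \o z) - c).
have cfst (p : X * X -> X) : continuous p ->
    continuous (fun z : config G (X * X) => (p \o z : config G X)).
  move=> cp; apply: config_continuous => g z.
  apply: (@continuous_comp _ _ _ (fun z : config G (X * X) => z g) p).
    exact: Defs.coord_continuous.
  exact: cp.
have cfp (p : X * X -> X) : continuous p ->
    continuous (fun z : config G (X * X) => f (p \o z) - c).
  move=> cp z; have cfz :
      {for z, continuous (fun z' : config G (X * X) => f (p \o z'))}.
    have h := cfst p cp; pose q (z : config G (X * X)) : config G X := p \o z.
    have cq : continuous q := h.
    exact: (continuous_comp (cq z) (cf (q z))).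
  exact: (cvgB cfz (cvg_cst c)).
have cF : continuous F.
  have c1 : continuous (fst : X * X -> X) by move=> y; exact: cvg_fst.
  have c2 : continuous (snd : X * X -> X) by move=> y; exact: cvg_snd.
  by move=> z; exact: (cvgM (cfp fst c1 z) (cfp snd c2 z)).
have [_ vF] := H F cF.
have bf : bddm f by exact: continuous_bddm.
have bfc : bddm (fun y => f y - c) by apply: bddmB => //; exact: bddm_cst.
have EF0 : Ex (prod_prob mu mu) F = 0.
  rewrite Ex_prod_prob//.
  under eq_fun => x.
    rewrite (_ : (fun y => _) = (fun y => (f x - c) * (f y - c)))//.
    rewrite ExZ// ExB//; last exact: bddm_cst.
    rewrite Ex_cst subrr mulr0; over.
  by rewrite Ex_cst.
apply: vanishing_le vF => n; rewrite /empirical_deviation EF0.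
pose h v (x : config (V n) X) := f (pullback (s n) v x) - c.
have ch v : continuous (h v).
  move=> x; have cfx : {for x, continuous (fun x' => f (pullback (s n) v x'))}.
    exact: (continuous_config_pullback cf).
  exact: (cvgB cfx (cvg_cst c)).
have bh v : bddm (h v) by exact: continuous_bddm.
have bA : bddm (\1_(A n) : _ -> R) by exact: bddm_indic.
pose k v x := \1_(A n) x * h v x.
have bk v : bddm (k v) by exact: bddmM.
have bFn v : continuous (fun z : config (V n) (X * X) => F (pullback (s n) v z)).
  exact: (continuous_config_pullback cF).
pose E (z : config (V n) X * config (V n) X) := avg (fun v => h v z.1 * h v z.2).
have -> : Ex (prod_prob (nu n) (nu n)) (fun z =>
    `|avg (fun v => F (pullback (s n) v z)) - 0|) =
    Ex (nu n) (fun x => Ex (nu n) (fun y => `|E (x, y)|)).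
  rewrite Ex_prod_prob.
    by congr Ex; apply/funext => x; congr Ex; apply/funext => y; rewrite subr0.
  move=> z; have cz := continuous_avg bFn.
  exact: (cvg_norm (cvgB (cz z) (cvg_cst 0))).
have bEk : bddm (fun x => Ex (nu n) (fun y => avg (fun v => k v x * k v y))).
  rewrite (_ : (fun _ => _) = (fun x => avg (fun v => Ex (nu n) (k v) * k v x))).
    by apply: bddmZ; apply: bddm_sum => v; exact: bddmZ.
  apply/funext => x; rewrite /avg ExZ; last by apply: bddm_sum => v; exact: bddmZ.
  rewrite Ex_sum; last by move=> v; exact: bddmZ.
  by congr (_ * _); apply: eq_bigr => v _; rewrite ExZ// mulrC.
(* Squares of means are integrals over independent pairs. *)
rewrite (_ : avg _ = Ex (nu n) (fun x => Ex (nu n)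
    (fun y => avg (fun v => k v x * k v y)))); last first.
  under [in RHS]eq_fun => x.
    rewrite /avg ExZ; last by apply: bddm_sum => v; exact: bddmZ.
    rewrite Ex_sum; last by move=> v; exact: bddmZ.
    under eq_bigr do rewrite ExZ// mulrC.
    over.
  rewrite ExZ; last by apply: bddm_sum => v; exact: bddmZ.
  rewrite Ex_sum; last by move=> v; exact: bddmZ.
  by congr (_ * _); apply: eq_bigr => v _; rewrite ExZ// expr2.
have bE : bddm (fun z => `|E z|).
  apply: bddm_norm; apply: bddmZ; apply: bddm_sum => v; apply: bddmM.
    by apply: (bddm_comp (h := fst) (bh v)); exact: measurable_fst.
  by apply: (bddm_comp (h := snd) (bh v)); exact: measurable_snd.
apply: le_Ex => // [|x]; first exact: (bddm_Ex_pair (nu n) (nu n) bE).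
apply: le_Ex => [||y].
- by apply: bddmZ; apply: bddm_sum => v; exact: bddmZ.
- by apply: (bddm_comp (h := pair x) bE); exact: pair1_measurable.
rewrite (_ : avg _ = (\1_(A n) x * \1_(A n) y) * E (x, y)); last first.
  by rewrite -avgZ; congr avg; apply/funext => v; rewrite /k mulrACA.
apply: (le_trans (ler_norm _)); rewrite normrM ler_piMl//.
rewrite !indicE; case: (_ \in _); case: (_ \in _);
  by rewrite ?mulr0 ?mul0r ?mulr1 ?normr0 ?normr1 ?ler01.
Qed.

End product_convergence.

(** * Products of a finite weight *)

Section product_weights.
Context {R : realType} {J W : finType}.
Variable p : J -> R.
Hypothesis p0 : forall j, 0 <= p j.
Hypothesis p1 : \sum_j p j = 1.
Implicit Types (phi : {ffun W -> J}) (g h : J -> R).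

Definition pweight phi : R := \prod_w p (phi w).

Lemma pweight_ge0 phi : 0 <= pweight phi.
Proof. exact: prodr_ge0. Qed.

Lemma sum_pweightM (F : W -> J -> R) :
  \sum_phi pweight phi * \prod_w F w (phi w) =
  \prod_w \sum_j p j * F w j.
Proof.
rewrite [RHS]bigA_distr_bigA /=; apply: eq_bigr => phi _.
by rewrite -big_split.
Qed.

Lemma sum_pweight : \sum_phi pweight phi = 1.
Proof.
transitivity (\sum_phi pweight phi * \prod_(w : W) (1 : R)).
  by apply: eq_bigr => phi _; rewrite big1_eq mulr1.
rewrite (sum_pweightM (fun _ _ => 1)) big1// => w _.
by under eq_bigr do rewrite mulr1.
Qed.

Lemma sum_pweight_coord (w0 : W) g :
  \sum_phi pweight phi * g (phi w0) = \sum_j p j * g j.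
Proof.
pose F w j := if w == w0 then g j else 1.
transitivity (\sum_phi pweight phi * \prod_w F w (phi w)).
  apply: eq_bigr => phi _; rewrite (bigD1 w0)//= {1}/F eqxx.
  by rewrite [X in _ = _ * (_ * X)]big1 ?mulr1// => w /negPf; rewrite /F => ->.
rewrite sum_pweightM (bigD1 w0)//= [X in _ * X]big1 ?mulr1 /F ?eqxx//.
move=> w /negPf ->; by under eq_bigr do rewrite mulr1.
Qed.

Lemma sum_pweight_coord2 (w1 w2 : W) g h : w1 != w2 ->
  \sum_phi pweight phi * (g (phi w1) * h (phi w2)) =
  (\sum_j p j * g j) * (\sum_j p j * h j).
Proof.
move=> w12; have w21 : w2 == w1 = false by rewrite eq_sym; exact/negbTE.
pose F w j := if w == w1 then g j else if w == w2 then h j else 1.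
transitivity (\sum_phi pweight phi * \prod_w F w (phi w)).
  apply: eq_bigr => phi _; rewrite (bigD1 w1)//= (bigD1 w2) ?w21//=.
  rewrite [X in _ = _ * (_ * (_ * X))]big1 ?mulr1 /F ?eqxx ?w21// => w.
  by move=> /andP[/negPf -> /negPf ->].
rewrite sum_pweightM (bigD1 w1)//= (bigD1 w2) ?w21//=.
rewrite [X in _ * (_ * X)]big1 ?mulr1 /F ?eqxx ?w21//.
move=> w /andP[/negPf -> /negPf ->]; by under eq_bigr do rewrite mulr1.
Qed.

(** The off-diagonal terms are products of means, hence zero. *)
Lemma sum_pweight_variance (Z : J -> R) (M : R) :
  \sum_j p j * Z j = 0 -> (forall j, `|Z j| <= M) ->
  \sum_phi pweight phi * (\sum_w Z (phi w)) ^+ 2 <= #|W|%:R * M ^+ 2.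
Proof.
move=> Z0 ZM.
rewrite (eq_bigr (fun phi => \sum_w1 \sum_w2
    pweight phi * (Z (phi w1) * Z (phi w2)))); last first.
  move=> phi _; rewrite expr2 big_distrlr /= mulr_sumr; apply: eq_bigr => w1 _.
  by rewrite mulr_sumr.
rewrite exchange_big /=.
have -> : #|W|%:R * M ^+ 2 = \sum_(w in W) M ^+ 2 by rewrite sumr_const mulr_natl.
apply: ler_sum => w1 _; rewrite exchange_big /= (bigD1 w1)//=.
rewrite [X in _ + X]big1 => [|w2 w21]; last first.
  by rewrite sum_pweight_coord2 1?eq_sym// Z0 mul0r.
rewrite addr0 (sum_pweight_coord w1 (fun j => Z j * Z j)) -[leRHS]mul1r -p1.
rewrite mulr_suml; apply: ler_sum => j _; rewrite ler_wpM2l// -expr2.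
by rewrite -[leLHS]ger0_norm ?sqr_ge0// normrX lerXn2r// ?nnegrE//
  (le_trans _ (ZM j)).
Qed.

End product_weights.

Section product_deviation.
Context {R : realType} {J : finType} {W : neFinType}.
Variable p : J -> R.
Hypothesis p0 : forall j, 0 <= p j.
Hypothesis p1 : \sum_j p j = 1.

(** Weak law of large numbers, in the mean. *)
Lemma pweight_deviation (Z : J -> R) (m M t : R) : 0 < t ->
  m = \sum_j p j * Z j -> (forall j, `|Z j - m| <= M) ->
  \sum_(phi : {ffun W -> J}) pweight p phi * `|avg (fun w => Z (phi w)) - m|
    <= t + t^-1 * (M ^+ 2 / #|W|%:R).
Proof.
move=> t0 mE ZM; have W0 : 0 < #|W|%:R :> R by exact: card_gt0R.
(* Passes from the variance to the mean absolute deviation. *)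
have amgm (a : R) : 0 <= a -> a <= t + t^-1 * a ^+ 2.
  move=> a0; have [at_|ta] := leP a t.
    by rewrite (le_trans at_)// lerDl mulr_ge0 ?sqr_ge0 ?invr_ge0 ?ltW.
  apply: (@le_trans _ _ (t^-1 * a ^+ 2)); last by rewrite lerDr ltW.
  by rewrite expr2 mulrA ler_peMl// mulrC ler_pdivlMr// mul1r ltW.
apply: (@le_trans _ _ (\sum_(phi : {ffun W -> J}) pweight p phi *
    (t + t^-1 * (#|W|%:R^-1 ^+ 2 * (\sum_w (Z (phi w) - m)) ^+ 2)))).
  apply: ler_sum => phi _; rewrite ler_wpM2l ?pweight_ge0//.
  rewrite -exprMn -/(avg (fun w => Z (phi w) - m)) avgB avg_cst.
  by rewrite (le_trans (amgm _ (normr_ge0 _)))// -normrX ger0_norm// sqr_ge0.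
under eq_bigr do rewrite mulrDr.
rewrite big_split /= -mulr_suml sum_pweight// mul1r lerD2l.
under eq_bigr do rewrite mulrCA [X in _ * X]mulrCA.
rewrite -!mulr_sumr ler_pM2l ?invr_gt0//.
have /= V := @sum_pweight_variance R J W p p0 p1 (fun j => Z j - m) M.
have Z0 : \sum_j p j * (Z j - m) = 0.
  under eq_bigr do rewrite mulrBr.
  by rewrite sumrB -mE -mulr_suml p1 mul1r subrr.
apply: (@le_trans _ _ (#|W|%:R^-1 ^+ 2 * (#|W|%:R * M ^+ 2))).
  by rewrite ler_wpM2l ?sqr_ge0//; exact: V.
by rewrite expr2 -mulrA mulKf ?gt_eqF// mulrC.
Qed.

Lemma pweight_markov (A : pred {ffun W -> J}) (f : {ffun W -> J} -> R) (t : R) :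
  0 < t -> (forall phi, 0 <= f phi) -> (forall phi, A phi -> t <= f phi) ->
  \sum_(phi | A phi) pweight p phi <= t^-1 * \sum_phi pweight p phi * f phi.
Proof.
move=> t0 f0 tf; rewrite big_mkcond mulr_sumr; apply: ler_sum => phi _.
have w0 := pweight_ge0 p0 phi.
case: (boolP (A phi)) => [/tf tA|_]; last by rewrite !mulr_ge0// invr_ge0 ltW.
by rewrite mulrCA -[leLHS]mulr1 ler_wpM2l// ler_pdivlMl// mulr1.
Qed.

End product_deviation.

(** Two independent samples of a product are one sample of the product of the
    pairs. *)
Lemma sum_pweight_pair (R : realType) (J J' W : finType) (p : J -> R)
    (q : J' -> R) (K : {ffun W -> J} -> {ffun W -> J'} -> R) :
  \sum_phi pweight p phi * \sum_psi pweight q psi * K phi psi =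
  \sum_(chi : {ffun W -> J * J'}) pweight (fun jj => p jj.1 * q jj.2) chi *
    K [ffun w => (chi w).1] [ffun w => (chi w).2].
Proof.
under eq_bigr do rewrite mulr_sumr.
rewrite pair_bigA /=.
rewrite (reindex (fun chi : {ffun W -> J * J'} =>
  ([ffun w => (chi w).1], [ffun w => (chi w).2]))) /=; last first.
  exists (fun ab : {ffun W -> J} * {ffun W -> J'} =>
    [ffun w => (ab.1 w, ab.2 w)]) => [chi _|[a b] _].
    by apply/ffunP => w; rewrite !ffunE -surjective_pairing.
  by congr pair; apply/ffunP => w; rewrite !ffunE.
apply: eq_bigr => chi _; rewrite mulrA /pweight -big_split /=.
by congr (_ * _); apply: eq_bigr => w _; rewrite !ffunE.
Qed.

Section hamming.
Context {R : realType} {I V W : finType}.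
Implicit Types a b : {ffun W -> {ffun V -> I}}.

Definition hamming a b : nat := \sum_w \sum_v (a w v != b w v).

(** Exponential moment bound: give weight [t] to each disagreement. *)
Lemma hamming_ball_card (b : {ffun W -> {ffun V -> I}}) (k : nat) (t : R) :
  0 < t <= 1 ->
  #|[pred a | (hamming a b <= k)%N]|%:R * t ^+ k <=
  expR (#|I|%:R * t * (#|V| * #|W|)%:R).
Proof.
move=> /andP[t0 t1].
pose c w v i : R := if i != b w v then t else 1.
have cE a : \prod_w \prod_v c w v (a w v) = t ^+ hamming a b.
  rewrite /hamming -prodrXr; apply: eq_bigr => w _.
  rewrite -prodrXr; apply: eq_bigr => v _.
  by rewrite /c; case: (_ != _).
have c0 w v i : 0 <= c w v i by rewrite /c; case: ifP => // _; exact: ltW.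
apply: (@le_trans _ _ (\sum_(a : {ffun W -> {ffun V -> I}})
  \prod_w \prod_v c w v (a w v))).
  rewrite -sum1_card natr_sum mulr_suml big_mkcond /=.
  apply: ler_sum => a _; rewrite cE inE; case: ifP => H.
    by rewrite mul1r ler_wiXn2l// ltW.
  by rewrite exprn_ge0// ltW.
rewrite -(bigA_distr_bigA (fun w (f : {ffun V -> I}) => \prod_v c w v (f v))).
under eq_bigr do rewrite -bigA_distr_bigA.
apply: (@le_trans _ _ (\prod_(w in W) \prod_(v in V) expR (#|I|%:R * t))).
  apply: ler_prod => w _; apply/andP; split.
    by apply: prodr_ge0 => v _; apply: sumr_ge0.
  apply: ler_prod => v _; apply/andP; split; first exact: sumr_ge0.
  apply: le_trans (expR_ge1Dx _).
  rewrite (bigD1 (b w v))//= /c eqxx /= lerD2l.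
  apply: (@le_trans _ _ (\sum_(i in I) t)).
    rewrite big_mkcond; apply: ler_sum => i _.
    case: ifP => H; rewrite ?H ?(ltW t0) ?lexx//.
  by rewrite sumr_const mulr_natl.
by rewrite !prodr_const -!expRM_natr -mulrA -natrM.
Qed.

End hamming.

Section information.
Context {R : realType}.

Lemma ln_le_sub1 (x : R) : 0 < x -> ln x <= x - 1.
Proof.
move=> x0; rewrite -(@ler_expR R) lnK ?posrE//.
by have := expR_ge1Dx (x - 1); rewrite addrC subrK.
Qed.

Context {J K W : finType}.
Variables (p : J -> R) (name : J -> K).
Hypothesis p0 : forall j, 0 <= p j.
Hypothesis p1 : \sum_j p j = 1.

Definition name_weight (b : K) : R := \sum_(j | name j == b) p j.

(** Truncated information content: probabilities smaller than [beta] count as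
    [beta], which makes it bounded and costs little entropy. *)
Definition info (beta : R) (j : J) : R := - ln (Num.max (name_weight (name j)) beta).

Lemma name_weight_ge0 b : 0 <= name_weight b.
Proof. exact: sumr_ge0. Qed.

Lemma name_weight_le1 b : name_weight b <= 1.
Proof.
rewrite -p1 /name_weight big_mkcond; apply: ler_sum => j _.
by case: ifP.
Qed.

Lemma info_bounds beta j : 0 < beta <= 1 -> 0 <= info beta j <= - ln beta.
Proof.
move=> /andP[b0 b1]; rewrite /info.
have m0 : 0 < Num.max (name_weight (name j)) beta by rewrite lt_max b0 orbT.
rewrite oppr_ge0 lerN2 ln_le0 ?ge_max ?name_weight_le1//=.
by rewrite ler_ln ?posrE// le_max lexx orbT.
Qed.

(** A name of probability [q < beta] contributes [q * ln (beta / q) <= beta] to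
    the loss. *)
Lemma info_mean beta : 0 < beta <= 1 ->
  - \sum_b name_weight b * ln (name_weight b) - #|K|%:R * beta <=
  \sum_j p j * info beta j.
Proof.
move=> /andP[b0 b1].
rewrite (partition_big name xpredT)//=.
rewrite [leRHS](_ : _ = \sum_b name_weight b *
    - ln (Num.max (name_weight b) beta)); last first.
  apply: eq_bigr => b _; rewrite {1}/name_weight mulr_suml.
  by apply: eq_bigr => j /eqP <-.
rewrite -sumrN mulr_natl -sumr_const -sumrB; apply: ler_sum => b _.
have w0 := name_weight_ge0 b; rewrite mulrN -opprD lerN2.
have [bw|wb] := leP beta (name_weight b); first by rewrite lerDl ltW.
move: w0; rewrite le_eqVlt => /predU1P[<-|w0]; first by rewrite !mul0r add0r ltW.
rewrite -lerBlDl -mulrBr -ln_div ?posrE//.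
apply: (@le_trans _ _ (name_weight b * (beta / name_weight b))).
  rewrite ler_pM2l// (le_trans (ln_le_sub1 _)) ?divr_gt0//.
  by rewrite gerBl.
by rewrite mulrC divfK// gt_eqF.
Qed.

Lemma sum_pweight_name (a : {ffun W -> K}) :
  \sum_(phi : {ffun W -> J} | [forall w, name (phi w) == a w]) pweight p phi =
  \prod_w name_weight (a w).
Proof.
pose F w j : R := (name j == a w)%:R.
transitivity (\prod_w \sum_j p j * F w j); last first.
  apply: eq_bigr => w _; rewrite /name_weight [RHS]big_mkcond.
  by apply: eq_bigr => j _; rewrite /F; case: eqP; rewrite ?mulr1 ?mulr0.
rewrite -sum_pweightM big_mkcond; apply: eq_bigr => phi _.
case: forallP => [H|H].
  by rewrite big1 ?mulr1// => w _; rewrite /F H.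
have [w Hw] : exists w, name (phi w) != a w.
  by apply: contrapT => H'; apply: H => w; apply/negPn/negP => ?; apply: H';
    exists w.
by rewrite (bigD1 w)//= /F (negPf Hw) mul0r mulr0.
Qed.

End information.

(** All the samples with the same name as a member of [B] have together the
    product of the name probabilities as weight, hence at most [expR (- L)]; it
    remains to count the names, which lie in one Hamming ball. *)
Lemma pweight_hamming_set (R : realType) (J I V W : finType) (p : J -> R)
    (name : J -> {ffun V -> I}) (beta L t : R) (k : nat)
    (B : pred {ffun W -> J}) :
  (forall j, 0 <= p j) -> 0 < beta -> 0 < t <= 1 ->
  (forall phi psi, B phi -> B psi ->
    (hamming [ffun w => name (phi w)] [ffun w => name (psi w)] <= k)%N) ->
  (forall phi, B phi -> L <= \sum_w info p name beta (phi w)) ->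
  \sum_(phi | B phi) pweight p phi <=
    expR (#|I|%:R * t * (#|V| * #|W|)%:R) / t ^+ k * expR (- L).
Proof.
move=> p0 b0 t01 Bk BL; have /andP[t0 _] := t01.
have tk : 0 < t ^+ k by rewrite exprn_gt0.
have [phi0 B0|B0] := pickP B; last first.
  by rewrite big_pred0// !mulr_ge0 ?expR_ge0// invr_ge0 ltW.
pose nm (phi : {ffun W -> J}) := 
  [ffun w => name (phi w)] : {ffun W -> {ffun V -> I}}.
pose Hb := [pred a | (hamming a (nm phi0) <= k)%N].
rewrite (partition_big nm Hb) => [|phi Bphi]; last exact: Bk.
apply: (@le_trans _ _ (\sum_(a in Hb) expR (- L))); last first.
  rewrite sumr_const -[leLHS]mulr_natl ler_wpM2r ?expR_ge0//.
  by rewrite ler_pdivlMr//; exact: hamming_ball_card.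
apply: ler_sum => a _.
have [phi /andP[Bphi /eqP na]|N] := pickP [pred phi | B phi && (nm phi == a)];
  last by rewrite big_pred0// expR_ge0.
apply: (@le_trans _ _ (\sum_(psi : {ffun W -> J} |
    [forall w, name (psi w) == a w]) pweight p psi)).
  rewrite big_mkcond [leRHS]big_mkcond; apply: ler_sum => psi _.
  case: ifP => [/andP[_ /eqP npsi]|_]; last by case: ifP => // _; exact: pweight_ge0.
  rewrite ifT//; apply/forallP => w; rewrite -npsi ffunE//.
rewrite sum_pweight_name.
apply: (@le_trans _ _ (expR (- \sum_w info p name beta (phi w)))); last first.
  by rewrite ler_expR lerN2; exact: BL.
rewrite -sumrN expR_sum; apply: ler_prod => w _.
have w0 := name_weight_ge0 name p0.
rewrite w0 /= /info opprK -na ffunE lnK ?posrE ?le_max ?lexx//.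
by rewrite lt_max b0 orbT.
Qed.

(** * Names for a finite partition *)

Section labelling.
Context {R : realType} {X : compactMetricType R}.

(** Stands for the finite Borel partition into the fibres of [c]. *)
Definition borel_label (I : finType) (c : X -> I) :=
  forall i, <<s @open X >> (c @^-1` [set i]).

Lemma partition_label (P : set (set X)) : finite_borel_partition P ->
  exists (I : finType) (c : X -> I), [/\ borel_label c,
    (forall i, exists x, c x = i) & P = range (fun i => c @^-1` [set i])].
Proof.
move=> [/finite_fsetP[F PF] PB [PT /trivIsetP tP P0]].
pose I : finType := seq_sub (finmap.enum_fset F).
have Pval (A : I) : P (val A) by rewrite PF /=; exact: (valP A).
have Pin A : P A -> exists i : I, val i = A.
  by rewrite PF => FA; exists (SeqSub FA).
have /choice[c cP] : forall x, exists i : I, val i x.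
  move=> x; have : [set: X] x by [].
  by rewrite -PT => -[A /Pin[i <-] Ax]; exists i.
have cE i : c @^-1` [set i] = val i.
  apply/seteqP; split=> [x <-|x ix]; first exact: cP.
  apply: val_inj; apply: contrapT => /eqP ne.
  have := tP _ _ (Pval (c x)) (Pval i) ne; apply/eqP/set0P.
  by exists x; split.
exists I, c; split=> [i|i|].
- by rewrite cE; exact: PB.
- by have [x xi] := P0 _ (Pval i); exists x; rewrite -cE in xi.
- apply/seteqP; split=> [A /Pin[i <-]|_ [i _ <-]]; last by rewrite cE.
  by exists i => //; rewrite cE.
Qed.

Lemma measurable_coord (V : countType) (v : V) (B : set X) :
  <<s @open X >> B -> measurable [set x : config V X | B (x v)].
Proof.
move=> mB; pose f : config V X -> g_sigma_algebraType (@open X) := fun x => x v.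
have mf : measurable_fun setT f.
  apply: (@measurability _ _ _ _ _ f (@open X)) => //.
  move=> _ [D oD <-]; rewrite setTI; apply: open_measurable_config.
  by have /continuousP := @Defs.coord_continuous V X v; apply.
by have := mf measurableT B mB; rewrite setTI.
Qed.

Section names.
Context {V : neFinType} {I : finType}.
Variable c : X -> I.

Definition cname (x : config V X) : {ffun V -> I} := [ffun v => c (x v)].

Lemma measurable_cname b : borel_label c ->
  measurable [set x : config V X | cname x = b].
Proof.
move=> mc.
rewrite (_ : mkset _ =
    \bigcap_(v in [set: V]) [set x : config V X | (c @^-1` [set b v]) (x v)]).
  apply: fin_bigcap_measurable => // v _; exact: measurable_coord.
apply/seteqP; split=> [x <- v _ /=|x H]; first by rewrite ffunE.
by apply/ffunP => v; rewrite ffunE; exact: H.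
Qed.

Definition nprob (nu : probability (config V X) R) b : R :=
  fine (nu [set x | cname x = b]).

Lemma nprob_ge0 nu b : 0 <= nprob nu b.
Proof. by rewrite /nprob fine_ge0. Qed.

Lemma Ex_cname (nu : probability (config V X) R) (g : {ffun V -> I} -> R) :
  borel_label c ->
  bddm (fun x => g (cname x)) /\
  Ex nu (fun x => g (cname x)) = \sum_b nprob nu b * g b.
Proof.
move=> mc; pose A b := [set x : config V X | cname x = b].
have mA b : measurable (A b) by exact: measurable_cname.
have E : (fun x => g (cname x)) = (fun x => \sum_b g b * \1_(A b) x).
  apply/funext => x; rewrite (bigD1 (cname x))//= indicE mem_set// mulr1.
  rewrite big1 ?addr0// => b bx; rewrite indicE memNset ?mulr0//.
  by move=> /= xb; rewrite -xb eqxx in bx.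
have bE b : bddm (fun x => g b * \1_(A b) x).
  by apply: bddmZ; exact: bddm_indic.
rewrite E; split; first exact: bddm_sum.
rewrite Ex_sum//; apply: eq_bigr => b _.
by rewrite ExZ; [rewrite Ex_indic// mulrC|exact: bddm_indic].
Qed.

Lemma sum_nprob nu : borel_label c -> \sum_b nprob nu b = 1.
Proof.
move=> mc; have [_] := Ex_cname nu (fun=> 1) mc; rewrite Ex_cst => ->.
by apply: eq_bigr => b _; rewrite mulr1.
Qed.

(** Distinct names have distinct cells because every label is taken. *)
Lemma shannon_nprob (nu : probability (config V X) R) :
  (forall i, exists x, c x = i) ->
  shannon nu (partition_power (range (fun i => c @^-1` [set i]))) =
  - \sum_b nprob nu b * ln (nprob nu b).
Proof.
move=> /choice[r rc]; rewrite /shannon; congr (- _).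
pose h (b : {ffun V -> I}) := [set x : config V X | cname x = b].
have inj : injective h.
  move=> b b' bb'; have : h b (fun v => r (b v)).
    by apply/ffunP => v; rewrite ffunE rc.
  rewrite bb' => E; apply/ffunP => v.
  have := congr1 (fun f : {ffun V -> I} => f v) E; rewrite /= ffunE rc => ->//.
have -> : partition_power (range (fun i => c @^-1` [set i])) = h @` setT.
  apply/seteqP; split=> [A [C [PC ->]]|_ [b _ <-]].
    have /choice[b bC] : forall v, exists i, c @^-1` [set i] = C v.
      by move=> v; have [i _ iC] := PC v; exists i.
    exists [ffun v => b v] => //; apply/seteqP; split=> x.
      move=> E v; rewrite -bC; have := congr1 (fun f : {ffun V -> I} => f v) E.
      by rewrite /= !ffunE.
    by move=> H; apply/ffunP => v; rewrite !ffunE; have := H v; rewrite -bC.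
  exists (fun v => c @^-1` [set b v]); split; first by move=> v; exists (b v).
  apply/seteqP; split=> [x <- v /=|x H]; first by rewrite ffunE.
  by apply/ffunP => v; rewrite ffunE; exact: H.
rewrite fsbig_image; last by move=> b b' _ _; exact: inj.
have -> : [set: {ffun V -> I}] = [set` index_enum {ffun V -> I}].
  by apply/seteqP; split=> // b _ /=; rewrite mem_index_enum.
by rewrite -fsbig_seq ?index_enum_uniq.
Qed.

End names.

(** One atom is put in each cell of the partition generated by both labellings:
    refining the first one preserves the law of the names, refining the second
    one keeps every atom within [r] of the points that it replaces. *)
Lemma discretization (V : neFinType) (I I' : finType) (c : X -> I)
    (c' : X -> I') (r : R) (nu : probability (config V X) R) :
  borel_label c -> borel_label c' ->
  (forall x y, c' x = c' y -> mdist x y < r) ->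
  exists (J : finType) (p : J -> R) (x : J -> config V X),
  [/\ forall j, 0 <= p j, \sum_j p j = 1,
      forall b, \sum_(j | cname c (x j) == b) p j = nprob c nu b &
      forall (f : config V X -> R) (e : R), bddm f ->
        (forall y z : config V X, (forall v, mdist (y v) (z v) < r) ->
          `|f y - f z| <= e) ->
        `|\sum_j p j * f (x j) - Ex nu f| <= e].
Proof.
move=> mc mc' cr; pose cc (x : X) := (c x, c' x).
have mcc : borel_label cc.
  move=> [i i']; have -> : cc @^-1` [set (i, i')] =
      c @^-1` [set i] `&` c' @^-1` [set i'].
    by apply/seteqP; split=> [x [<- <-]|x [<- <-]].
  exact: (@measurableI _ (g_sigma_algebraType (@open X)) _ _ (mc i) (mc' i')).
pose A b := [set x : config V X | cname cc x = b].
have /choice[x xP] : forall b, exists x, A b !=set0 -> A b x.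
  move=> b.
  have [[y Ay]|N] := pselect (A b !=set0); first by exists y.
  by exists point.
have xP' y : cname cc (x (cname cc y)) = cname cc y by apply: xP; exists y.
have cP' y v : cc (x (cname cc y) v) = cc (y v).
  have := congr1 (fun f : {ffun V -> I * I'} => f v) (xP' y).
  by rewrite /= !ffunE.
exists {ffun V -> I * I'}, (nprob cc nu), x; split.
- by move=> j; exact: nprob_ge0.
- exact: sum_nprob.
- move=> b; rewrite /nprob -Ex_indic; last exact: measurable_cname.
  have [_] := Ex_cname nu (fun a => (cname c (x a) == b)%:R : R) mcc.
  move=> E; rewrite big_mkcond /=; transitivity
    (\sum_a nprob cc nu a * ((cname c (x a) == b)%:R : R)).
    by apply: eq_bigr => a _; case: eqP; rewrite ?mulr1 ?mulr0.
  rewrite -E; congr Ex; apply/funext => y; rewrite indicE; congr (nat_of_bool _)%:R.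
  have -> : cname c (x (cname cc y)) = cname c y.
    by apply/ffunP => v; rewrite !ffunE; have := cP' y v => -[].
  by apply/eqP/idP => [E'|/set_mem//]; exact: mem_set.
- move=> f e bf fe.
  have [bfx <-] := Ex_cname nu (fun a => f (x a)) mcc.
  apply: Ex_dist => // y; apply: fe => v; apply: cr.
  by have := cP' y v => -[].
Qed.

End labelling.

(** * Entropy of averaged marginals *)

(** Gibbs' inequality against the product of [#|W|] copies of the averaged
    marginal [q]. *)
Lemma entropy_average_marginal (R : realType) (A K : finType) (W : neFinType)
    (sl : A -> {ffun W -> K}) (rho : A -> R) (q : K -> R) (M : R) :
  injective sl -> (forall a, 0 <= rho a) -> \sum_a rho a = 1 -> 0 < M ->
  (forall a, rho a * M <= 1) ->
  (forall b, q b = avg (fun w => \sum_(a | sl a w == b) rho a)) ->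
  ln M <= #|W|%:R * - \sum_b q b * ln (q b).
Proof.
move=> inj r0 r1 M0 rM qE.
have q0 b : 0 <= q b by rewrite qE; apply: avg_ge0 => w; exact: sumr_ge0.
have q1 : \sum_b q b = 1.
  under eq_bigr do rewrite qE; rewrite -avg_sum -[RHS](@avg_cst R W).
  congr avg; apply/funext => w; rewrite -r1.
  by rewrite [RHS](partition_big (fun a => sl a w) xpredT).
have qpos a w : 0 < rho a -> 0 < q (sl a w).
  move=> ra; rewrite qE /avg mulr_gt0 ?invr_gt0 ?card_gt0R//.
  apply: (lt_le_trans ra); rewrite (bigD1 w)//= (bigD1 a)//=.
  by rewrite -addrA lerDl addr_ge0// sumr_ge0// => w' _; exact: sumr_ge0.
pose Q a := \prod_w q (sl a w).
have Q0 a : 0 <= Q a by exact: prodr_ge0.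
have Q1 : \sum_a Q a <= 1.
  rewrite -(sum_pweight q1 (W := W)).
  rewrite (_ : \sum_a Q a = \sum_(phi in [set sl a | a : A]%SET) pweight q phi).
    rewrite big_mkcond; apply: ler_sum => phi _.
    by case: ifP => // _; exact: pweight_ge0.
  by rewrite big_imset//= => a b _ _; exact: inj.
have gibbs a : rho a * (ln M + \sum_w ln (q (sl a w))) <= Q a - rho a.
  have := r0 a; rewrite le_eqVlt => /predU1P[<-|ra].
    by rewrite mul0r subr0.
  have Qa : 0 < Q a by apply: prodr_gt0 => w _; exact: qpos.
  have -> : \sum_w ln (q (sl a w)) = ln (Q a).
    rewrite -[LHS]expRK expR_sum; congr ln; apply: eq_bigr => w _.
    by rewrite lnK// posrE; exact: qpos.
  rewrite -lnM ?posrE//; apply: (@le_trans _ _ (rho a * (Q a / rho a - 1))).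
    rewrite ler_pM2l// (le_trans _ (ln_le_sub1 _)) ?divr_gt0//.
    rewrite ler_ln ?posrE ?divr_gt0 ?mulr_gt0// ler_pdivlMr// mulrAC.
    by rewrite ler_piMl// mulrC.
  by rewrite mulrBr mulr1 mulrC divfK// gt_eqF.
have : \sum_a rho a * (ln M + \sum_w ln (q (sl a w))) <= 0.
  apply: (le_trans (ler_sum _ (fun a _ => gibbs a))).
  by rewrite sumrB r1 subr_le0.
under eq_bigr do rewrite mulrDr mulr_sumr.
rewrite big_split /= -mulr_suml r1 mul1r exchange_big /=.
rewrite (_ : \sum_(w : W) _ = #|W|%:R * \sum_b q b * ln (q b)).
  by rewrite mulrN; lra.
transitivity (#|W|%:R * 
  avg (fun w => \sum_b (\sum_(a | sl a w == b) rho a) * ln (q b))).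
  rewrite /avg mulVKf ?gt_eqF ?card_gt0R//; apply: eq_bigr => w _.
  rewrite (partition_big (fun a => sl a w) xpredT)//=; apply: eq_bigr => b _.
  by rewrite mulr_suml; apply: eq_bigr => a /eqP ->.
rewrite avg_sum; congr (_ * _); apply: eq_bigr => b _; rewrite qE.
by rewrite [in RHS]mulrC -avgZ; congr avg; apply/funext => w; rewrite mulrC.
Qed.

Lemma continuous_mdist (R : realType) (X : metricType R) (x : X) :
  continuous (mdist x : X -> R).
Proof.
move=> y.
apply: (proj2 (@cvgrPdist_le R _ X (nbhs y) _ (mdist x : X -> R) (mdist x y))).
move=> t t0; have := nbhsx_ballx y _ t0.
rewrite ballEmdist; apply: filterS => z /= /ltW yz.
rewrite ler_norml; apply/andP; split.
  have := metric_triangle x y z; lra.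
have := metric_triangle x z y; rewrite (metric_sym z); lra.
Qed.

(** [K] is the covering number itself.  A cell whose points share their name lies
    in a ball, so a family of fewer than [K] names has mass at most [1 - eps];
    the names of probability more than [1 / K] form such a family, and [B] is
    its complement. *)
Lemma subset_of_large_information (R : realType) (X : compactMetricType R)
    (V : neFinType) (I : finType) (c : X -> I) (delta eps : R)
    (mu : probability (config V X) R) :
  borel_label c -> (forall x y, c x = c y -> mdist x y < delta) ->
  0 < eps < 1 ->
  exists (K : nat) (B : pred {ffun V -> I}),
  [/\ (0 < K)%N, cov eps delta mu = K%:R%:E,
      forall b, B b -> K%:R * nprob c mu b <= 1 &
      eps <= \sum_(b | B b) nprob c mu b].
Proof.
move=> mc cd /andP[e0 e1].
pose A b := [set x : config V X | cname c x = b].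
have mA b : measurable (A b) by exact: measurable_cname.
have /choice[ctr ctrP] : forall b, exists x, A b !=set0 -> A b x.
  move=> b; have [[y Ay]|N] := pselect (A b !=set0); first by exists y.
  by exists point.
pose S (n : nat) := exists ct : 'I_n -> config V X,
  ((1 - eps)%:E <
   mu (\bigcup_(i : 'I_n) [set y | (mean_dist (ct i) y < delta)%R]))%E.
have cmd (v : V) (x : X) : continuous (fun y : config V X => mdist x (y v) : R).
  move=> y; have cv := @Defs.coord_continuous V X v.
  exact: (continuous_comp (cv y) (@continuous_mdist R X x (y v))).
have cont (x : config V X) : continuous (mean_dist x : config V X -> R).
  exact: (continuous_avg (fun v => cmd v (x v))).
have mball n (ct : 'I_n -> config V X) :
    measurable (\bigcup_(i : 'I_n) [set y | mean_dist (ct i) y < delta]).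
  apply: fin_bigcup_measurable => // i _; apply: open_measurable_config.
  have /continuousP := cont (ct i).
  by move=> /(_ [set r | r < delta]); apply; exact: open_lt.
(* The names in [B] with positive probability provide centres for a cover. *)
pose mass (B : pred {ffun V -> I}) := \sum_(b | B b) nprob c mu b.
have massE (B : pred {ffun V -> I}) (D : set (config V X)) : measurable D ->
    (forall x, B (cname c x) -> D x) -> ((mass B)%:E <= mu D)%E.
  move=> mD BD; have [bB] := Ex_cname mu (fun b => (B b)%:R : R) mc.
  move=> EB; rewrite -[mu D]fineK ?fin_num_measure// lee_fin -Ex_indic//.
  rewrite /mass big_mkcond (_ : \sum_b _ = \sum_b nprob c mu b * (B b)%:R).
    rewrite -EB; apply: le_Ex => //; first exact: bddm_indic.
    move=> x; rewrite indicE; case: (boolP (B _)) => [/BD Dx|_]; last exact: ler0n.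
    by rewrite mem_set.
  by apply: eq_bigr => b _; case: (B b); rewrite ?mulr1 ?mulr0.
have cover (B : pred {ffun V -> I}) : (forall b, B b -> 0 < nprob c mu b) ->
    1 - eps < mass B -> S #|B|.
  move=> Bpos Bm; exists (fun i => ctr (enum_val i)).
  apply: (@lt_le_trans _ _ (mass B)%:E); first by rewrite lte_fin.
  apply: massE => // x Bx; exists (enum_rank_in Bx (cname c x)) => //=.
  rewrite enum_rankK_in//.
  have cx : A (cname c x) (ctr (cname c x)) by apply: ctrP; exists x.
  have lt v : mdist (ctr (cname c x) v) (x v) < delta.
    apply: cd; have := congr1 (fun f : {ffun V -> I} => f v) cx.
    by rewrite /= !ffunE.
  rewrite /mean_dist -[ltRHS](@avg_cst R V) /avg ltr_pM2l ?invr_gt0 ?card_gt0R//.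
  apply: ltr_sum => [|v _]; last exact: lt.
  case: (@inhabited_subproof V) => v; apply/hasP.
  by exists v => //; exact: mem_index_enum.

have Sne : exists n, `[< S n >].
  pose B0 : pred {ffun V -> I} := fun b => 0 < nprob c mu b.
  exists #|B0|; apply/asboolP; apply: cover => //.
  rewrite /mass (_ : \sum_(b | _) _ = 1) ?ltrBlDr ?ltrDl//.
  rewrite -(sum_nprob mu mc) [RHS](bigID (fun b => 0 < nprob c mu b))/=.
  rewrite [X in _ + X]big1 ?addr0// => b; rewrite -leNgt => b0.
  by apply/eqP; rewrite eq_le b0 nprob_ge0.
pose K := ex_minn Sne.
have [SK Kmin] : S K /\ forall n, S n -> (K <= n)%N.
  rewrite /K; case: ex_minnP => k /asboolP Sk kmin; split => // n Sn.
  by apply: kmin; apply/asboolP.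
have K0 : (0 < K)%N.
  case: (posnP K) => // K0; move: SK; rewrite K0 => -[ct].
  rewrite (_ : \bigcup_(i : 'I_0) _ = set0); last first.
    by apply/seteqP; split => // y [[]].
  by rewrite measure0 lte_fin; lra.
exists K, [pred b | K%:R * nprob c mu b <= 1]; split => //.
- apply/eqP; rewrite eq_le; apply/andP; split.
    by apply: ereal_inf_lbound; exists K.
  by apply: le_ereal_inf_tmp => _ [n Sn <-]; rewrite lee_fin ler_nat; exact: Kmin.
- set B := [pred b | K%:R * nprob c mu b <= 1].
  pose B' : pred {ffun V -> I} := fun b => ~~ B b.
  have KR0 : 0 < K%:R :> R by rewrite ltr0n.
  have B'lt b : B' b -> 1 < K%:R * nprob c mu b by rewrite /B' /= -ltNge.
  have B'pos b : B' b -> 0 < nprob c mu b.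
    by move=> /B'lt /(lt_trans ltr01); rewrite pmulr_rgt0.
  rewrite leNgt; apply/negP => lt.
  have tot : \sum_(b | B b) nprob c mu b + mass B' = 1.
    by rewrite -(sum_nprob mu mc) [RHS](bigID B).
  have KB : (K <= #|B'|)%N.
    by apply: Kmin; apply: cover => //; rewrite -tot; lra.
  have : #|B'|%:R < \sum_(b | B' b) K%:R * nprob c mu b.
    rewrite -sum1_card natr_sum; apply: ltr_sum => [|b /B'lt//].
    have : (0 < #|B'|)%N by exact: leq_trans KB.
    by case/card_gt0P => b Bb; apply/hasP; exists b; rewrite ?mem_index_enum.
  rewrite -mulr_sumr -/(mass B') ltNge => /negP; apply.
  apply: (@le_trans _ _ K%:R); last by rewrite ler_nat.
  rewrite ler_piMr// -tot lerDr; apply: sumr_ge0 => b _; exact: nprob_ge0.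
Qed.

(** * The upper bound *)

Section upper_bound.
Context {R : realType} {X : compactMetricType R}.

Definition slice (V W : neFinType) (w : W) (x : config (V * W) X) : config V X :=
  fun v => x (v, w).

Lemma measurable_slice (V W : neFinType) (w : W) :
  measurable_fun setT (@slice V W w).
Proof.
apply: continuous_config_measurable; apply: config_continuous => v.
exact: (@Defs.coord_continuous (V * W)%type X (v, w)).
Qed.

Lemma pullback_inflate (G : countGroupType) (V W : neFinType)
    (s : G -> {perm V}) (v : V) (w : W) (x : config (V * W) X) :
  pullback (inflate s) (v, w) x = pullback s v (slice w x).
Proof. by apply/funext => g; rewrite /pullback /inflate permE. Qed.

Lemma avg_pair (V W : neFinType) (g : V * W -> R) :
  avg g = avg (fun v => avg (fun w => g (v, w))).
Proof.
rewrite /avg -mulr_sumr pair_bigA /= card_prod natrM invfM -mulrA.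
by congr (_ * (_ * _)); apply: eq_bigr => -[].
Qed.

Lemma conditional_marginal (V W : neFinType)
    (mu : probability (config (V * W) X) R) (A : set (config (V * W) X)) :
  measurable A -> 0 < fine (mu A) ->
  exists nu : probability (config V X) R, forall f, bddm f ->
    Ex nu f = (fine (mu A))^-1 *
      avg (fun w => Ex mu (fun x => \1_A x * f (slice w x))).
Proof.
move=> mA A0.
have [||nu [_ nuE]] := @finite_mixture R _ _ _ _ mu A mA W
  (fun=> (fine (mu A))^-1 * #|W|%:R^-1) (@slice V W) _ (@measurable_slice V W).
- by move=> _; apply: mulr_ge0; rewrite invr_ge0 ?ler0n// ltW.
- rewrite sumr_const -[X in X = _]mulr_natl.
  rewrite [X in _ * X]mulrAC mulVf ?gt_eqF// mul1r mulfV// gt_eqF//.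
  exact: card_gt0R.
exists nu => f bf; rewrite nuE// /avg mulr_sumr mulr_sumr.
by apply: eq_bigr => w _; rewrite mulrA.
Qed.

(** Conditioned on the set given by [subset_of_large_information], each name has
    probability at most [(K * eps)^-1]; the entropy of the averaged marginal
    dominates the resulting information [ln (K * eps)] up to the factor
    [#|W|]. *)
Lemma large_entropy_marginal (V W : neFinType) (I : finType) (c : X -> I)
    (delta eps : R) (mu : probability (config (V * W) X) R) :
  borel_label c -> (forall x y, c x = c y -> mdist x y < delta) ->
  0 < eps < 1 ->
  exists (A : set (config (V * W) X)) (nu : probability (config V X) R),
  [/\ measurable A, eps <= fine (mu A),
      forall f, bddm f -> Ex nu f = (fine (mu A))^-1 *
        avg (fun w => Ex mu (fun x => \1_A x * f (slice w x))) &
      (lne (cov eps delta mu) <= (#|W|%:R *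
        - (\sum_b nprob c nu b * ln (nprob c nu b)) - ln eps)%:E)%E].
Proof.
move=> mc cd e01; have /andP[e0 e1] := e01.
have [K [B [K0 covE BK eB]]] := subset_of_large_information mu mc cd e01.
pose A := [set x : config (V * W) X | B (cname c x)].
have mA : measurable A.
  rewrite (_ : A = \bigcup_(b in [set b | B b]) [set x | cname c x = b]).
    by apply: fin_bigcup_measurable => // b _; exact: measurable_cname.
  apply/seteqP; split=> [x Bx|x [b Bb /= xb]]; first by exists (cname c x).
  by rewrite /A /= xb.
have indE x : \1_A x = (B (cname c x))%:R :> R.
  rewrite indicE; congr (nat_of_bool _)%:R.
  by apply/idP/idP => [/set_mem//|Bx]; exact: mem_set.
have muA : fine (mu A) = \sum_(b | B b) nprob c mu b.
  have [_] := Ex_cname mu (fun b => (B b)%:R : R) mc.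
  rewrite -Ex_indic// => E; rewrite (_ : (\1_A : _ -> R) =
    (fun x => (B (cname c x))%:R)); last by apply/funext.
  rewrite E [RHS]big_mkcond; apply: eq_bigr => b _.
  by case: (B b); rewrite ?mulr1 ?mulr0.
have A0 : 0 < fine (mu A) by rewrite muA; exact: lt_le_trans eB.
have [nu nuE] := conditional_marginal mA A0.
exists A, nu; split => //; first by rewrite muA.
rewrite covE lne_EFin ?ltr0n// lee_fin.
pose sl (a : {ffun V * W -> I}) : {ffun W -> {ffun V -> I}} :=
  [ffun w => [ffun v => a (v, w)]].
pose rho a := if B a then nprob c mu a / fine (mu A) else 0.
have KR0 : 0 < K%:R :> R by rewrite ltr0n.
have H := @entropy_average_marginal R {ffun V * W -> I} {ffun V -> I} W sl rho
  (nprob c nu) (K%:R * eps).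
rewrite lerBrDr -lnM ?posrE//; apply: H.
- move=> a a' aa'; apply/ffunP => -[v w].
  have := congr1 (fun f : {ffun W -> {ffun V -> I}} => f w v) aa'.
  by rewrite /= !ffunE.
- by move=> a; rewrite /rho; case: ifP => // _; rewrite divr_ge0 ?nprob_ge0 ?ltW.
- by rewrite -big_mkcond /= -mulr_suml -muA mulfV// gt_eqF.
- exact: mulr_gt0.
- move=> a; rewrite /rho; case: ifP => [/BK Ba|_]; last by rewrite mul0r ler01.
  rewrite mulrAC ler_pdivrMr// mul1r mulrA [_ * K%:R]mulrC.
  rewrite (le_trans _ (_ : eps <= _)) ?muA// ler_piMl// ltW//.
- move=> b; rewrite /nprob -Ex_indic; last exact: measurable_cname.
  rewrite nuE; last by apply: bddm_indic; exact: measurable_cname.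
  rewrite -avgZ; congr avg; apply/funext => w.
  have [_] := Ex_cname mu (fun a => (B a && (sl a w == b))%:R : R) mc.
  move=> E; transitivity ((fine (mu A))^-1 *
      Ex mu (fun x => (B (cname c x) && (sl (cname c x) w == b))%:R)).
    congr (_ * _); congr Ex; apply/funext => x; rewrite indE indicE -natrM mulnb.
    congr (nat_of_bool (_ && _))%:R.
    have -> : sl (cname c x) w = cname c (slice w x).
      by apply/ffunP => v; rewrite !ffunE.
    by apply/idP/eqP => [/set_mem//|H']; exact: mem_set.
  rewrite E mulr_sumr [RHS]big_mkcond; apply: eq_bigr => a _; rewrite /rho.
  by case: (B a); case: (_ == b); rewrite /= ?mulr1 ?mulr0// mulrC.
Qed.

Context {G : countGroupType} (V W : nat -> neFinType).
Variables (s : forall n, G -> {perm V n}) (mu : probability (config G X) R).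

(** The local laws of the averaged conditional marginal are controlled through
    the mean square estimate of [restricted_deviation_square]. *)
Lemma lde_upper_bound (I : finType) (c : X -> I) (delta eps : R)
    (mu_ : forall n, probability (config (V n * W n) X) R) :
  borel_label c -> (forall x y, c x = c y -> mdist x y < delta) ->
  0 < eps < 1 ->
  lde_conv (V := fun n => (V n * W n)%type)
    (fun n => inflate (W := W n) (s n)) mu_ mu ->
  exists nu_ : forall n, probability (config (V n) X) R, lw_conv s nu_ mu /\
    forall n, (lne (cov eps delta (mu_ n)) <= (#|W n|%:R *
      - (\sum_b nprob c (nu_ n) b * ln (nprob c (nu_ n) b)) - ln eps)%:E)%E.
Proof.
move=> mc cd e01 lde; have /andP[e0 e1] := e01.
have cX : compact [set: X] by exact: compact_setT.
have AnuP n := large_entropy_marginal (mu_ n) mc cd e01.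
pose A n := sval (cid (AnuP n)).
have nuP n := svalP (cid (AnuP n)).
pose nu n := sval (cid (nuP n)).
have nuE n := svalP (cid (nuP n)).
exists nu; split; last by move=> n; case: (nuE n).
have mA n : measurable (A n) by case: (nuE n).
have eA n : eps <= fine (mu_ n (A n)) by case: (nuE n).
have nuf n f : bddm f -> Ex (nu n) f = (fine (mu_ n (A n)))^-1 *
    avg (fun w => Ex (mu_ n) (fun x => \1_(A n) x * f (slice w x))).
  by have [_ _ H _] := nuE n; exact: H.
apply/(lw_convP cX) => f cf.
have bf : bddm f by exact: continuous_bddm.
have vsq := restricted_deviation_square mA cf lde.
set c0 := Ex mu f in vsq *.
pose k n v w := Ex (mu_ n) (fun x => \1_(A n) x *
  (f (pullback (s n) v (slice w x)) - c0)).
pose sq n := avg (fun v => avg (fun w => (k n v w) ^+ 2)).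
have vsq' : vanishing sq.
  apply: vanishing_le vsq => n; rewrite avg_pair.
  apply: le_avg => v; apply: le_avg => w.
  rewrite /k; under [in leLHS]eq_fun do rewrite -pullback_inflate.
  exact: lexx.
have A0 n : 0 < fine (mu_ n (A n)) by exact: lt_le_trans (eA n).
apply: (@vanishing_split _ _ (fun _ => sq) (fun t => eps^-1 * (eps * t)^-1))
  => [t t0|t n t0].
  by split => //; rewrite mulr_ge0// invr_ge0 ltW// mulr_gt0.
have et : 0 < eps * t by exact: mulr_gt0.
(* Passes from the mean square to the mean of the absolute value. *)
have amgm (a : R) : `|a| <= eps * t + (eps * t)^-1 * a ^+ 2.
  rewrite -real_normK ?num_real//; have := normr_ge0 a; set b := `|a| => b0.
  have [bt|tb] := leP b (eps * t).
    by rewrite (le_trans bt)// lerDl mulr_ge0 ?sqr_ge0 ?invr_ge0 ?ltW.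
  apply: (@le_trans _ _ ((eps * t)^-1 * b ^+ 2)); last by rewrite lerDr ltW.
  by rewrite expr2 mulrA ler_peMl// mulrC ler_pdivlMr// mul1r ltW.
have dev v : `|Ex (nu n) (fun x => f (pullback (s n) v x)) - c0| <=
    eps^-1 * avg (fun w => `|k n v w|).
  have bfv : bddm (fun x : config (V n) X => f (pullback (s n) v x)).
    exact: bddm_pullback.
  have bA : bddm (\1_(A n) : _ -> R) by exact: bddm_indic.
  have bfs w : bddm (fun x => f (pullback (s n) v (@slice (V n) (W n) w x))).
    by apply: (bddm_comp bfv); exact: measurable_slice.
  rewrite nuf// (_ : _ - c0 = (fine (mu_ n (A n)))^-1 * avg (k n v)); last first.
    have -> : c0 = (fine (mu_ n (A n)))^-1 * avg (fun w : W n =>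
        c0 * Ex (mu_ n) (\1_(A n))).
      by rewrite avg_cst Ex_indic// mulrCA mulVf ?mulr1// gt_eqF.
    rewrite -mulrBr -avgB; congr (_ * avg _); apply/funext => w.
    rewrite -ExZ// -ExB; [|exact: bddmM|exact: bddmZ].
    rewrite /k; congr Ex; apply/funext => x.
    by rewrite mulrBr [c0 * _]mulrC.
  have mi : 0 <= (fine (mu_ n (A n)))^-1 by rewrite invr_ge0 ltW.
  rewrite normrM (ger0_norm mi); apply: ler_pM => //.
    by rewrite lef_pV2 ?posrE//; exact: eA.
  exact: le_norm_avg.
apply: (@le_trans _ _ (avg (fun v => eps^-1 * avg (fun w =>
    eps * t + (eps * t)^-1 * (k n v w) ^+ 2)))).
  apply: le_avg => v; apply: (le_trans (dev v)).
  by rewrite ler_pM2l ?invr_gt0//; apply: le_avg => w; exact: amgm.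
rewrite avgZ (_ : avg _ = eps * t + (eps * t)^-1 * sq n); last first.
  rewrite -[X in X + _](@avg_cst R (V n)) -avgZ -avgD; congr avg.
  by apply/funext => v; rewrite -avgZ -[X in X + _](@avg_cst R (W n)) -avgD.
by rewrite mulrDr mulKf ?gt_eqF// mulrA.
Qed.

End upper_bound.

(** * Distance to the other cells *)

Section boundary_distance.
Context {R : realType} {X : compactMetricType R} {I : finType}.
Variable c : X -> I.

(** Distance to the points with another label; the value [1] keeps the infimum
    over a nonempty set when there is only one label. *)
Definition label_gap (x : X) : R :=
  inf [set r | r = 1 \/ exists2 y, c y <> c x & r = mdist x y].

Lemma label_gap_ge0 x : 0 <= label_gap x.
Proof.
apply: lb_le_inf; first by exists 1; left.
by move=> _ [->|[y _ ->]]; [exact: ler01|exact: mdist_ge0].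
Qed.

Lemma has_inf_gap x :
  has_inf [set r : R | r = 1 \/ exists2 y, c y <> c x & r = mdist x y].
Proof.
split; first by exists 1; left.
by exists 0 => _ [->|[y _ ->]]; [exact: ler01|exact: mdist_ge0].
Qed.

Lemma label_gap_le x y : c y <> c x -> label_gap x <= mdist x y.
Proof.
by move=> cyx; apply: ge_inf; [case: (has_inf_gap x)|right; exists y].
Qed.

Lemma label_gap_lip x y : label_gap x <= label_gap y + mdist x y.
Proof.
have [cxy|cxy] := eqVneq (c y) (c x); last first.
  apply: (le_trans (label_gap_le (y := y) _)); first exact/eqP.
  by rewrite lerDr label_gap_ge0.
rewrite -lerBlDr; apply: lb_le_inf; first by exists 1; left.
move=> _ [->|[z cz ->]]; rewrite lerBlDr.
  apply: (@le_trans _ _ 1); last by rewrite lerDl mdist_ge0.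
  by apply: ge_inf; [case: (has_inf_gap x)|left].
apply: (@le_trans _ _ (mdist x z)); first by apply: label_gap_le; rewrite -cxy.
by rewrite addrC; exact: metric_triangle.
Qed.

Lemma label_gap_eq0 x : label_gap x = 0 -> boundary (c @^-1` [set c x]) x.
Proof.
move=> u0; split; first exact: subset_closure.
move=> /nbhs_ballP[e /= e0]; rewrite ballEmdist => eD.
have : Num.min 1 e <= label_gap x.
  apply: lb_le_inf; first by exists 1; left.
  move=> _ [->|[y cy ->]]; first by rewrite ge_min lexx.
  rewrite ge_min; have [xy|_] := ltP (mdist x y) e; last by rewrite orbT.
  by case: cy; exact: eD.
by rewrite u0 leNgt lt_min ltr01 e0.
Qed.

(** A continuous substitute for the indicator of the points within [r] of
    another label; it vanishes at the points whose gap is at least [2 * r]. *)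
Definition gap_bump (r : R) (x : X) : R := Num.max 0 (2 - r^-1 * label_gap x).

Lemma gap_bump_ge0 r x : 0 <= gap_bump r x.
Proof. by rewrite le_max lexx. Qed.

Lemma gap_bump_ge1 r x y : 0 < r -> mdist x y < r -> c y <> c x ->
  1 <= gap_bump r x.
Proof.
move=> r0 xy cy; rewrite le_max; apply/orP; right.
rewrite lerBrDr addrC -lerBrDr ler_pdivrMl//.
rewrite (le_trans (label_gap_le cy))//; rewrite (_ : 2 - 1 = 1) ?mulr1 ?ltW//.
by rewrite -[2]/(1 + 1)%:R natrD addrK.
Qed.

Lemma gap_bump_lip r x y : 0 < r ->
  `|gap_bump r x - gap_bump r y| <= r^-1 * mdist x y.
Proof.
move=> r0; have h a b : gap_bump r a - gap_bump r b <= r^-1 * mdist a b.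
  rewrite lerBlDr /gap_bump ge_max addr_ge0 ?le_max ?lexx ?mulr_ge0 ?mdist_ge0
    ?invr_ge0 ?(ltW r0)//=.
  rewrite (@le_trans _ _ (r^-1 * mdist a b + (2 - r^-1 * label_gap b)))//.
    have := label_gap_lip b a; rewrite -(ler_pM2l (_ : 0 < r^-1)) ?invr_gt0//.
    rewrite mulrDr (metric_sym b a); lra.
  by rewrite lerD2l le_max lexx orbT.
rewrite ler_norml lerNl opprB h andbT metric_sym; exact: h.
Qed.

Lemma continuous_gap_bump r : 0 < r -> continuous (gap_bump r).
Proof.
move=> r0 y.
apply: (proj2 (@cvgrPdist_le R _ X (nbhs y) _ (gap_bump r) (gap_bump r y))).
move=> t t0; have rt : 0 < r * t by exact: mulr_gt0.
have := nbhsx_ballx y _ rt; rewrite ballEmdist; apply: filterS => z /= /ltW yz.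
by rewrite (le_trans (gap_bump_lip y z r0))// ler_pdivrMl.
Qed.

Lemma continuous_label_gap : continuous label_gap.
Proof.
move=> y.
apply: (proj2 (@cvgrPdist_le R _ X (nbhs y) _ label_gap (label_gap y))).
move=> t t0; have := nbhsx_ballx y _ t0.
rewrite ballEmdist; apply: filterS => z /= /ltW yz.
have := label_gap_lip y z; have := label_gap_lip z y.
by rewrite (metric_sym z y) ler_norml => ? ?; apply/andP; split; lra.
Qed.

Context {G : countGroupType}.
Variable mu : probability (config G X) R.
Hypothesis c_null : forall i,
  mu [set x | boundary (c @^-1` [set i]) (x 1%g)] = 0%E.

Lemma measurable_boundary (B : set X) :
  measurable [set x : config G X | boundary B (x 1%g)].
Proof.
apply: (@measurable_coord _ _ _ 1%g (boundary B)).
apply: (@measurableD _ (g_sigma_algebraType (@open X))).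
  rewrite -(setCK (closure B)).
  apply: (@measurableC _ (g_sigma_algebraType (@open X))).
  by apply: sub_sigma_algebra; rewrite openC; exact: closed_closure.
by apply: sub_sigma_algebra; exact: open_interior.
Qed.

(** The sets where the gap is below [1 / m] decrease to a subset of the union
    of the boundaries, which is null. *)
Lemma gap_bump_small (e : R) : 0 < e ->
  exists2 r, 0 < r & Ex mu (fun x => gap_bump r (x 1%g)) <= e.
Proof.
move=> e0; have e2 : 0 < e / 2 by rewrite divr_gt0.
pose D m := [set x : config G X | label_gap (x 1%g) < m.+1%:R^-1].
have cg : continuous (fun x : config G X => label_gap (x 1%g)).
  move=> x; have cv := @Defs.coord_continuous G X 1%g.
  exact: (continuous_comp (cv x) (@continuous_label_gap (x 1%g))).
have mD m : measurable (D m).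
  apply: open_measurable_config; have /continuousP := cg.
  by move=> /(_ [set r | r < m.+1%:R^-1]); apply; exact: open_lt.
have mcap : measurable (\bigcap_m D m) by exact: bigcap_measurable.
have capD : fine (mu (\bigcap_m D m)) = 0.
  apply/eqP; rewrite eq_le fine_ge0// andbT -Ex_indic//.
  pose B i := [set x : config G X | boundary (c @^-1` [set i]) (x 1%g)].
  have bB i : bddm (\1_(B i) : _ -> R).
    by apply: bddm_indic; exact: measurable_boundary.
  apply: (@le_trans _ _ (Ex mu (fun x => \sum_i \1_(B i) x))).
    apply: le_Ex => [||x]; [exact: bddm_indic|exact: bddm_sum|].
    rewrite indicE; case: (boolP (x \in _)) => [|_]; last first.
      by apply: sumr_ge0 => i _; rewrite indicE ler0n.
    rewrite inE => Dx; rewrite (bigD1 (c (x 1%g)))//= indicE mem_set.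
      by rewrite lerDl; apply: sumr_ge0 => i _; rewrite indicE ler0n.
    apply: label_gap_eq0.
    apply/eqP; rewrite eq_le label_gap_ge0 andbT; apply/ler_addgt0Pl => t t0.
    have [m mt] : exists m : nat, m.+1%:R^-1 < t.
      exists (Num.truncn t^-1); rewrite invf_plt ?posrE//.
      exact: truncnS_gt.
    by rewrite addr0 ltW// (lt_trans (Dx m Logic.I)).
  rewrite Ex_sum// big1// => i _; rewrite Ex_indic; last exact: measurable_boundary.
  by rewrite /B c_null.
have Dcvg : (fun m => mu (D m)) @ \oo --> mu (\bigcap_m D m).
  apply: nonincreasing_cvg_mu => //.
    exact: le_lt_trans (probability_le1 mu (mD 0)) (ltry _).
  move=> m k mk; apply/subsetPset => x /= /lt_le_trans; apply.
  by rewrite lef_pV2 ?posrE// ler_nat ltnS.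
have [m Dm] : exists m, fine (mu (D m)) <= e / 2.
  have : fine (mu (D m)) @[m --> \oo] --> fine (mu (\bigcap_m D m)).
    by apply: fine_cvg; rewrite fineK// fin_num_measure.
  rewrite capD => /cvgrPdist_le /(_ _ e2) [m _ /(_ m (leqnn m))] /=.
  by rewrite sub0r normrN => /(le_trans (ler_norm _)) H; exists m.
pose r : R := m.+1%:R^-1 / 2.
have r0 : 0 < r by rewrite divr_gt0 ?invr_gt0.
exists r => //.
apply: (@le_trans _ _ (Ex mu (fun x => 2 * \1_(D m) x))); last first.
  rewrite ExZ; last exact: bddm_indic.
  rewrite Ex_indic//; lra.
apply: le_Ex => [||x].
- apply: (continuous_bddm compact_setT) => x.
  have cv := @Defs.coord_continuous G X 1%g.
  exact: (continuous_comp (cv x) (@continuous_gap_bump r r0 (x 1%g))).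
- by apply: bddmZ; exact: bddm_indic.
- rewrite /gap_bump ge_max mulr_ge0 ?indicE ?ler0n//=.
  case: (boolP (x \in _)) => [_|/negP xD].
    by rewrite mulr1 gerBl mulr_ge0 ?label_gap_ge0// invr_ge0 ltW.
  have rE : r^-1 = 2 * m.+1%:R by rewrite /r invfM !invrK mulrC.
  rewrite mulr0 subr_le0 rE -mulrA ler_peMr// leNgt; apply/negP => H.
  apply: xD; apply/mem_set => /=.
  by rewrite /D /= -[X in _ < X]mulr1 ltr_pdivlMl.
Qed.

End boundary_distance.

(** * The product model *)

Section product_model.
Context {R : realType} {X : compactMetricType R} {G : countGroupType}.

(** The sample of the product whose [w]-th block is the [phi w]-th atom. *)
Definition assemble (V W : neFinType) (J : Type) (x : J -> config V X)
    (phi : {ffun W -> J}) : config (V * W) X := fun vw => x (phi vw.2) vw.1.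

Lemma Ex_pair_assemble (V W : neFinType) (J : finType) (p : J -> R)
    (x : J -> config V X) (Q : probability (config (V * W) X) R)
    (F : config (V * W) (X * X) -> R) :
  (forall f, bddm f -> Ex Q f = \sum_phi pweight p phi * f (assemble x phi)) ->
  continuous F ->
  Ex (prod_prob Q Q) F =
  \sum_(chi : {ffun W -> J * J}) pweight (fun jj => p jj.1 * p jj.2) chi *
    F (fun vw => (x (chi vw.2).1 vw.1, x (chi vw.2).2 vw.1)).
Proof.
move=> QE cF; rewrite Ex_prod_prob//.
have cFz : continuous (F \o (zip_config :
    config (V * W) X * config (V * W) X -> config (V * W) (X * X))).
  by move=> z; apply: continuous_comp; [exact: continuous_zip_config|exact: cF].
rewrite QE; last first.
  by apply: (continuous_bddm compact_setT); exact: (continuous_Ex_section cFz).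
under eq_bigr => phi _.
  rewrite QE; last first.
    by apply: (continuous_bddm compact_setT); exact: (continuous_section2 cFz).
  over.
rewrite (@sum_pweight_pair _ _ _ _ p p (fun phi psi =>
  F (zip_config (X := X) (assemble x phi, assemble x psi)))).
apply: eq_bigr => chi _; congr (_ * F _); apply/funext => -[v w].
by rewrite /zip_config /assemble /= !ffunE.
Qed.

Variables (V W : nat -> neFinType) (s : forall n, G -> {perm V n}).
Variable mu : probability (config G X) R.
Hypothesis W_large : vanishing (fun n => #|W n|%:R^-1 : R).
Variables (J : nat -> finType) (p : forall n, J n -> R)
  (x : forall n, J n -> config (V n) X).
Hypothesis p_ge0 : forall n j, 0 <= @p n j.
Hypothesis p_sum1 : forall n, \sum_j @p n j = 1.
Hypothesis x_local : forall f, continuous f -> vanishing (fun n =>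
  avg (fun v => `|\sum_j @p n j * f (pullback (s n) v (@x n j)) - Ex mu f|)).
Variable Q : forall n, probability (config (V n * W n) X) R.
Hypothesis QE : forall n f, bddm f ->
  Ex (Q n) f = \sum_phi pweight (@p n) phi * f (assemble (@x n) phi).

(** Local convergence only sees one coordinate of the product; the empirical
    distributions concentrate by the weak law of large numbers over [W n]. *)
Lemma product_model_lde :
  lde_conv (V := fun n => (V n * W n)%type)
    (fun n => inflate (W := W n) (s n)) Q mu.
Proof.
have cX : compact [set: X] by exact: compact_setT.
apply/(le_convP compact_pair) => F cF.
have vl : vanishing (local_deviation (V := fun n => (V n * W n)%type)
    (fun n => inflate (W := W n) (s n)) (fun n => prod_prob (Q n) (Q n))
    (prod_prob mu mu) F).
  apply: local_deviation_prod => // f cf.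
  apply: vanishing_le (x_local cf) => n.
  rewrite /local_deviation avg_pair; apply: le_avg => v.
  rewrite -[leRHS](@avg_cst R (W n)); apply: le_avg => w.
  rewrite QE; last by apply: (bddm_pullback cX).
  under eq_bigr => phi _.
    rewrite (_ : pullback _ _ _ = pullback (s n) v (@x n (phi w))); last first.
      by rewrite pullback_inflate.
    over.
  rewrite (sum_pweight_coord (p_sum1 n) w
    (fun j => f (pullback (s n) v (@x n j)))).
  exact: lexx.
split=> //.
have [_ [M FM]] := continuous_bddm compact_pair cF.
have M0 : 0 <= M by exact: le_trans (FM point).
set C := Ex (prod_prob mu mu) F.
set dl := local_deviation _ _ _ _ in vl.
apply: (@vanishing_split _ _ (fun t n => dl n + t^-1 * ((M + M) ^+ 2 * #|W n|%:R^-1))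
  (fun=> 1)) => [t t0|t n t0].
  split; first exact: ler01.
  apply: vanishingD => //; apply: vanishingZ; first by rewrite invr_ge0 ltW.
  by apply: vanishingZ => //; exact: sqr_ge0.
rewrite mul1r.
pose p2 (jj : J n * J n) := @p n jj.1 * @p n jj.2.
have p20 jj : 0 <= p2 jj by exact: mulr_ge0.
have p21 : \sum_jj p2 jj = 1.
  rewrite -(pair_bigA _ (fun j k => @p n j * @p n k)) /=.
  by under eq_bigr do rewrite -mulr_sumr p_sum1 mulr1; exact: p_sum1.
pose zz (jj : J n * J n) : config (V n) (X * X) :=
  fun v => (@x n jj.1 v, @x n jj.2 v).
pose Fv v jj := F (pullback (s n) v (zz jj)).
pose Z jj := avg (fun v => Fv v jj).
pose m := \sum_jj p2 jj * Z jj.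
have pbE (chi : {ffun W n -> J n * J n}) v w :
    pullback (inflate (s n)) (v, w)
      (fun vw => (@x n (chi vw.2).1 vw.1, @x n (chi vw.2).2 vw.1)) =
    pullback (s n) v (zz (chi w)).
  by apply/funext => g; rewrite /pullback /inflate permE.
have cFvw vw : continuous (fun z : config (V n * W n) (X * X) =>
    F (pullback (inflate (s n)) vw z)).
  exact: continuous_config_pullback.
have mC : `|m - C| <= dl n.
  rewrite /dl /local_deviation.
  apply: le_trans (le_norm_avg _); rewrite avgB avg_cst avg_pair.
  rewrite (_ : avg _ = m)//.
  transitivity (avg (fun v => \sum_jj p2 jj * Fv v jj)).
    congr avg; apply/funext => v; rewrite -[RHS](@avg_cst R (W n)).
    congr avg; apply/funext => w.
    rewrite (Ex_pair_assemble (@QE n))//.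
    under eq_bigr do rewrite pbE.
    exact: (sum_pweight_coord p21 w (Fv v)).
  by rewrite avg_sum; apply: eq_bigr => jj _; rewrite avgZ.
have ZM jj : `|Z jj - m| <= M + M.
  rewrite (le_trans (ler_normB _ _))// lerD//.
    by apply: avg_bound => v; exact: FM.
  rewrite (le_trans (ler_norm_sum _ _ _))//.
  rewrite -[leRHS]mul1r -p21 mulr_suml; apply: ler_sum => kk _.
  by rewrite normrM ger0_norm// ler_wpM2l//; apply: avg_bound => v; exact: FM.
rewrite /empirical_deviation (Ex_pair_assemble (@QE n)); last first.
  have cA := continuous_avg cFvw.
  by move=> z; exact: (cvg_norm (cvgB (cA z) (cvg_cst C))).
apply: (@le_trans _ _ (\sum_(chi : {ffun W n -> J n * J n}) pweight p2 chi *
    (`|avg (fun w => Z (chi w)) - m| + dl n))).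
  apply: ler_sum => chi _; rewrite ler_wpM2l ?pweight_ge0//.
  have -> : avg (fun vw => F (pullback (inflate (s n)) vw (fun vw =>
      (@x n (chi vw.2).1 vw.1, @x n (chi vw.2).2 vw.1)))) = avg (fun w => Z (chi w)).
    rewrite avg_pair /Z /avg -!mulr_sumr exchange_big mulrCA /=.
    congr (_ * (_ * _)); apply: eq_bigr => w _; apply: eq_bigr => v _.
    by rewrite pbE.
  rewrite -/C (_ : _ - C = (avg (fun w => Z (chi w)) - m) + (m - C)); last by lra.
  by rewrite (le_trans (ler_normD _ _))// lerD2l.
under eq_bigr do rewrite mulrDr.
rewrite big_split /= -mulr_suml sum_pweight// mul1r.
rewrite [dl n + _]addrC addrA lerD2r.
exact: pweight_deviation.
Qed.

End product_model.

(** * Covering numbers of the product model *)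

Section covering.
Context {R : realType} {X : compactMetricType R} {V W : neFinType}.
Context {I J : finType}.
Variables (c : X -> I) (p : J -> R) (x : J -> config V X).
Hypothesis p0 : forall j, 0 <= p j.
Hypothesis p1 : \sum_j p j = 1.
Variable Q : probability (config (V * W) X) R.
Hypothesis QE : forall B,
  Q B = (\sum_(phi | `[< B (assemble x phi) >]) pweight p phi)%:E.
Variables (h : X -> R) (r kappa t eta : R).
Hypothesis h0 : forall y, 0 <= h y.
Hypothesis r0 : 0 < r.
Hypothesis h1 : forall y z, mdist y z < r -> c z <> c y -> 1 <= h y.
Hypothesis kappa01 : 0 < kappa < 1.
Hypothesis t01 : 0 < t <= 1.
Hypothesis eta0 : 0 < eta.
Hypothesis It : #|I|%:R * t <= kappa.
Hypothesis eta_t : 2 * eta * - ln t <= kappa.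

Hypothesis deviation_small :
  kappa^-1 * (kappa / 16 + (kappa / 16)^-1 *
    ((ln #|I|%:R - ln kappa) ^+ 2 / #|W|%:R)) <= 1 / 8.
Hypothesis boundary_small : \sum_j p j * avg (fun v => h (x j v)) <= eta / 8.
Hypothesis W_big : ln 4 / #|W|%:R <= kappa.

Let N : R := (#|V| * #|W|)%:R.
Let name j := cname c (x j).
Let beta : R := kappa / #|{ffun V -> I}|%:R.
Let Z j : R := #|V|%:R^-1 * info p name beta j.
Let C : R := ln #|I|%:R - ln kappa.
Let m : R := \sum_j p j * Z j.
Let k := Num.truncn (2 * eta * N).

Let V0 : 0 < #|V|%:R :> R := card_gt0R.
Let W0 : 0 < #|W|%:R :> R := card_gt0R.
Let NE : N = #|V|%:R * #|W|%:R. Proof. by rewrite /N natrM. Qed.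
Let N0 : 0 < N. Proof. by rewrite NE mulr_gt0. Qed.
Let kappa0 : 0 < kappa. Proof. by case/andP: kappa01. Qed.

Let I1 : 1 <= #|I|%:R :> R.
Proof. by rewrite ler1n; apply/card_gt0P; exists (c point). Qed.

Let I0 : 0 < #|I|%:R :> R. Proof. exact: lt_le_trans I1. Qed.

Let KE : #|{ffun V -> I}|%:R = #|I|%:R ^+ #|V| :> R.
Proof. by rewrite card_ffun natrX. Qed.

Let K1 : 1 <= #|{ffun V -> I}|%:R :> R.
Proof. by rewrite KE exprn_ege1. Qed.

Let K0 : 0 < #|{ffun V -> I}|%:R :> R. Proof. exact: lt_le_trans K1. Qed.

Let beta01 : 0 < beta <= 1.
Proof.
rewrite /beta divr_gt0//= ler_pdivrMr// mul1r.
by case/andP: kappa01 => _ /ltW /le_trans; apply.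
Qed.

Let Z_bounds j : 0 <= Z j <= C.
Proof.
have /andP[i0 iB] := info_bounds name p0 p1 j beta01.
rewrite /Z; apply/andP; split.
  by apply: mulr_ge0 => //; rewrite invr_ge0 ltW.
rewrite ler_pdivrMl//; apply: (le_trans iB); rewrite /beta ln_div ?posrE// KE lnXn//.
rewrite opprB /C mulrBr (_ : ln #|I|%:R *+ _ = #|V|%:R * ln #|I|%:R) ?mulr_natl//.
rewrite -mulr_natl lerD2l lerN2.
have lk : ln kappa <= 0 by rewrite ln_le0// ltW//; case/andP: kappa01.
by rewrite -[leLHS]mulr_natl ler_neMl// ler1n card_neFin.
Qed.

Let m_bounds : 0 <= m <= C.
Proof.
apply/andP; split.
  by apply: sumr_ge0 => j _; rewrite mulr_ge0//; case/andP: (Z_bounds j).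
rewrite -[leRHS]mul1r -p1 mulr_suml; apply: ler_sum => j _.
by rewrite ler_wpM2l//; case/andP: (Z_bounds j).
Qed.

Let Z_dist j : `|Z j - m| <= C.
Proof.
have /andP[? ?] := Z_bounds j; have /andP[? ?] := m_bounds.
by rewrite ler_norml; apply/andP; split; lra.
Qed.

Let unlikely1 (phi : {ffun W -> J}) := kappa <= `|avg (fun w => Z (phi w)) - m|.

Let unlikely2 (phi : {ffun W -> J}) :=
  eta <= avg (fun w => avg (fun v => h (x (phi w) v))).

Let unlikely1_weight : \sum_(phi | unlikely1 phi) pweight p phi <= 1 / 8.
Proof.
apply: (le_trans (pweight_markov p0 kappa0
  (f := fun phi => `|avg (fun w => Z (phi w)) - m|) _ _)) => //.
apply: le_trans deviation_small; rewrite ler_pM2l ?invr_gt0//.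
by apply: pweight_deviation => //; rewrite divr_gt0.
Qed.

Let unlikely2_weight : \sum_(phi | unlikely2 phi) pweight p phi <= 1 / 8.
Proof.
pose g j := avg (fun v => h (x j v)).
have g0 j : 0 <= g j by exact: avg_ge0.
apply: (le_trans (pweight_markov p0 eta0
  (f := fun phi : {ffun W -> J} => avg (fun w => g (phi w))) _ _)) => //.
  by move=> phi; exact: avg_ge0.
rewrite ler_pdivrMl// div1r (_ : \sum_phi _ = \sum_j p j * g j)//.
rewrite -[RHS](@avg_cst R W).
transitivity (avg (fun w => \sum_(phi : {ffun W -> J}) pweight p phi * g (phi w))).
  by rewrite avg_sum; apply: eq_bigr => phi _; rewrite avgZ.
by congr avg; apply/funext => w; rewrite sum_pweight_coord.
Qed.

Let mean_dist_triangle (a b y : config (V * W) X) :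
  mean_dist a b <= mean_dist y a + mean_dist y b.
Proof.
rewrite /mean_dist -mulrDr ler_wpM2l ?invr_ge0// -big_split /=.
apply: ler_sum => vw _; rewrite (metric_sym (y vw)); exact: metric_triangle.
Qed.

Let NavgE (f : W -> V -> R) :
  N * avg (fun w => avg (fun v => f w v)) = \sum_w \sum_v f w v.
Proof.
rewrite NE /avg -mulr_sumr; set S := \sum_w _.
by field; rewrite !gt_eqF.
Qed.

(** Where the names differ, either the points are [r]-apart or the first one is
    close to another cell; the first case is rare in a small ball, the second
    for a likely sample. *)
Let hamming_small (y : config (V * W) X) (phi psi : {ffun W -> J}) :
  mean_dist y (assemble x phi) < r * eta / 2 ->
  mean_dist y (assemble x psi) < r * eta / 2 ->
  ~~ unlikely2 phi ->
  (hamming [ffun w => name (phi w)] [ffun w => name (psi w)] <= k)%N.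
Proof.
move=> yphi ypsi; rewrite /unlikely2 -ltNge => hphi.
rewrite /k Num.Theory.truncn_ge_nat; last first.
  by rewrite mulr_ge0 ?mulr_ge0 ?ltW.
pose d w v := mdist (x (phi w) v) (x (psi w) v).
apply: (@le_trans _ _ (N * avg (fun w => avg (fun v =>
    r^-1 * d w v + h (x (phi w) v))))).
  rewrite NavgE /hamming natr_sum; apply: ler_sum => w _.
  rewrite natr_sum; apply: ler_sum => v _; rewrite !ffunE.
  have d0 : 0 <= r^-1 * d w v.
    by apply: mulr_ge0; [rewrite invr_ge0 ltW|exact: mdist_ge0].
  case: eqVneq => [_|ne]; first by rewrite addr_ge0.
  have [dr|rd] := ltP (d w v) r.
    by apply: ler_wpDl => //; apply: (h1 dr) => E; rewrite E eqxx in ne.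
  by apply: ler_wpDr => //; rewrite ler_pdivlMl// mulr1.
rewrite mulrC ler_pM2r//.
have -> : avg (fun w => avg (fun v => r^-1 * d w v + h (x (phi w) v))) =
    r^-1 * mean_dist (assemble x phi) (assemble x psi) +
    avg (fun w => avg (fun v => h (x (phi w) v))).
  have -> : mean_dist (assemble x phi) (assemble x psi) =
      avg (fun w => avg (fun v => d w v)).
    rewrite -[LHS]/(avg (fun vw => mdist (assemble x phi vw) (assemble x psi vw))).
    rewrite avg_pair /avg -!mulr_sumr mulrCA exchange_big /=.
    by congr (_ * (_ * _)).
  rewrite -avgZ -avgD; congr avg; apply/funext => w.
  by rewrite -avgZ -avgD.
have md := mean_dist_triangle (assemble x phi) (assemble x psi) y.
have : r^-1 * mean_dist (assemble x phi) (assemble x psi) <= eta.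
  rewrite ler_pdivrMl//; lra.
by lra.
Qed.

(** Two of the three [kappa] pay for the size [t ^- k * expR (#|I| * t * N)] of
    the Hamming ball, the third for the deviation of the information. *)
Let ball_weight (y : config (V * W) X) :
  \sum_(phi | [&& ~~ unlikely1 phi, ~~ unlikely2 phi &
      mean_dist y (assemble x phi) < r * eta / 2]) pweight p phi <=
  expR (- (N * (m - 3 * kappa))).
Proof.
have /andP[t0 t1] := t01.
apply: (le_trans (@pweight_hamming_set R J I V W p name beta
    (N * (m - kappa)) t k _ p0 _ t01 _ _)).
- by case/andP: beta01.
- move=> phi psi /and3P[_ u2 yphi] /and3P[_ _ ypsi].
  exact: hamming_small yphi ypsi u2.
- move=> phi /and3P[+ _ _]; rewrite /unlikely1 -ltNge => dev.
  have -> : \sum_w info p name beta (phi w) = N * avg (fun w => Z (phi w)).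
    rewrite NE /avg /Z -mulr_sumr; set S := \sum_w _.
    by field; rewrite !gt_eqF.
  rewrite ler_pM2l//; move: dev; rewrite ltr_norml => /andP[]; lra.
rewrite -[t in t ^+ k](@lnK R) ?posrE// -expRM_natl -expRN -!expRD ler_expR.
have kN : k%:R <= 2 * eta * N.
  by rewrite /k -truncn_ge_nat ?mulr_ge0 ?(ltW eta0) ?(ltW N0).
have lt0 : 0 <= - ln t by rewrite oppr_ge0 ln_le0.
have a1 : k%:R * - ln t <= N * kappa.
  apply: (le_trans (ler_wpM2r lt0 kN)); rewrite mulrAC mulrC ler_pM2l//.
have a2 : #|I|%:R * t * N <= N * kappa by rewrite mulrC ler_pM2l.
rewrite -/N mulrBr !mulrDr; lra.
Qed.

(** At least a quarter of the mass lies in the balls and on likely samples.  Of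
    the five [kappa], three are lost in [ball_weight], one in the truncation of
    the information and one in the factor [1 / 4]. *)
Lemma product_cov_lower :
  ((#|V|%:R^-1 * - (\sum_b name_weight p (fun j => cname c (x j)) b *
      ln (name_weight p (fun j => cname c (x j)) b)) - 5 * kappa)%:E <=
   (#|((V * W)%type : neFinType)|%:R^-1)%:E * lne (cov (1 / 2) (r * eta / 2) Q))%E.
Proof.
rewrite -/name; set H := - _; pose e : R := expR (- (N * (m - 3 * kappa))).
have e0 : 0 < e by exact: expR_gt0.
have covE : ((e^-1 / 4)%:E <= cov (1 / 2) (r * eta / 2) Q)%E.
  apply: le_ereal_inf_tmp => _ [n [ct ctP] <-]; rewrite lee_fin.
  rewrite ler_pdivrMr// -[e^-1]mulr1 ler_pdivrMl//.
  move: ctP; rewrite QE lte_fin.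
  set B := \bigcup_i _ => BQ.
  pose bi (i : 'I_n) (phi : {ffun W -> J}) := [&& ~~ unlikely1 phi,
    ~~ unlikely2 phi & mean_dist (ct i) (assemble x phi) < r * eta / 2].
  have le1 : \sum_(phi : {ffun W -> J} | `[< B (assemble x phi) >]) pweight p phi <=
      \sum_(phi | unlikely1 phi) pweight p phi +
      \sum_(phi | unlikely2 phi) pweight p phi +
      \sum_(i < n) \sum_(phi | bi i phi) pweight p phi.
    rewrite [leLHS]big_mkcond [X in _ <= X + _ + _]big_mkcond.
    rewrite [X in _ <= _ + X + _]big_mkcond.
    under [X in _ <= _ + X]eq_bigr do rewrite big_mkcond.
    rewrite [X in _ <= _ + X]exchange_big -!big_split /=.
    apply: ler_sum => phi _; have w0 := pweight_ge0 p0 phi.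
    have i0 i : 0 <= (if bi i phi then pweight p phi else 0) by case: ifP.
    have s0 : 0 <= \sum_(i < n) (if bi i phi then pweight p phi else 0).
      exact: sumr_ge0.
    case: asboolP => [[i _ yi]|_]; last first.
      by rewrite !addr_ge0//; case: ifP.
    case: (boolP (unlikely1 phi)) => u1.
      by rewrite -addrA lerDl addr_ge0//; case: ifP.
    case: (boolP (unlikely2 phi)) => u2; first by rewrite add0r lerDl.
    rewrite !add0r (bigD1 i)//= {1}/bi u1 u2 yi lerDl.
    by apply: sumr_ge0 => i' _; exact: i0.
  have le2 : \sum_(i < n) \sum_(phi | bi i phi) pweight p phi <= n%:R * e.
    apply: (@le_trans _ _ (\sum_(i < n) e)).
      by apply: ler_sum => i _; exact: ball_weight.
    by rewrite sumr_const card_ord mulr_natl.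
  have := unlikely1_weight; have := unlikely2_weight; lra.
have N1 : 1 <= N by rewrite ler1n muln_gt0 !card_neFin.
have Ni0 : 0 < N^-1 by rewrite invr_gt0.
have cardE : #|((V * W)%type : neFinType)|%:R = N :> R by rewrite card_prod.
rewrite cardE.
have E0 : 0 < e^-1 / 4 by rewrite divr_gt0// invr_gt0.
apply: (@le_trans _ _ ((N^-1)%:E * lne (e^-1 / 4)%:E)%E); last first.
  rewrite lee_pmul2l// ?lte_fin// lee_lne//.
    by rewrite in_itv /= leey andbT lee_fin ltW.
  by rewrite in_itv /= leey andbT (le_trans _ covE)// lee_fin ltW.
rewrite lne_EFin// -EFinM lee_fin ln_div ?posrE ?invr_gt0//.
rewrite lnV ?posrE// /e expRK opprK mulrBr mulKf ?gt_eqF//.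
have mH : #|V|%:R^-1 * H - kappa <= m.
  rewrite /m /Z; under [leRHS]eq_bigr do rewrite mulrCA.
  rewrite -mulr_sumr.
  apply: (@le_trans _ _ (#|V|%:R^-1 * (H - kappa))).
    rewrite mulrBr lerD2l lerN2 ler_piMl ?(ltW kappa0)//.
    by rewrite invf_le1// ler1n card_neFin.
  rewrite ler_pM2l ?invr_gt0//; have := info_mean name p0 beta01.
  by rewrite /beta mulrC divfK// gt_eqF.
have l4 : N^-1 * ln 4 <= kappa.
  apply: le_trans W_big; rewrite mulrC ler_pM2l ?ln_gt0 ?ltr1n//.
  by rewrite lef_pV2 ?posrE// NE ler_peMl ?(ltW W0)// ler1n card_neFin.
lra.
Qed.

End covering.

(** * The lower bound *)

Lemma le_sixteenths (R : realFieldType) (a b e : R) :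
  a <= e / 16 -> b <= e / 16 -> a + b <= e / 8.
Proof. lra. Qed.

Lemma small_disagreement_rate (R : realType) (kappa t : R) :
  0 < kappa -> 0 < t <= 1 -> exists2 eta, 0 < eta & 2 * eta * - ln t <= kappa.
Proof.
move=> k0 /andP[t0 t1].
have l1 : 0 < 2 * (1 - ln t).
  by rewrite mulr_gt0// (lt_le_trans ltr01)// lerDl oppr_ge0 ln_le0.
have eta0 : 0 < kappa / (2 * (1 - ln t)) by exact: divr_gt0.
have H : kappa / (2 * (1 - ln t)) * (2 * (1 - ln t)) = kappa.
  by rewrite divfK// gt_eqF.
exists (kappa / (2 * (1 - ln t))) => //.
move: (kappa / _) eta0 H => eta eta0; move: (ln t) => a; lra.
Qed.

Section lower_bound.
Context {R : realType} {X : compactMetricType R} {G : countGroupType}.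
Variables (V W : nat -> neFinType) (s : forall n, G -> {perm V n}).
Variable mu : probability (config G X) R.
Hypothesis W_large : vanishing (fun n => #|W n|%:R^-1 : R).
Context {I : finType}.
Variable c : X -> I.
Hypothesis mc : borel_label c.
Hypothesis c_null : forall i,
  mu [set x | boundary (c @^-1` [set i]) (x 1%g)] = 0%E.
Hypothesis fine_label : forall r : R, 0 < r ->
  exists (I' : finType) (c' : X -> I'), borel_label c' /\
    forall x y, c' x = c' y -> mdist x y < r.

Let I1 : 1 <= #|I|%:R :> R.
Proof. by rewrite ler1n; apply/card_gt0P; exists (c point). Qed.

(** The model is the product over [W n] of a discretization of [nu n] on cells of
    diameter less than [1 / (n + 1)]. *)
Lemma lde_lower_bound (nu : forall n, probability (config (V n) X) R) :
  lw_conv s nu mu ->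
  exists mu_ : forall n, probability (config (V n * W n) X) R,
    lde_conv (V := fun n => (V n * W n)%type)
      (fun n => inflate (W := W n) (s n)) mu_ mu /\
    forall kappa, 0 < kappa < 1 -> exists2 delta, 0 < delta &
      \forall n \near \oo,
        ((#|V n|%:R^-1 * - (\sum_b nprob c (nu n) b * ln (nprob c (nu n) b))
            - 5 * kappa)%:E <=
         (#|((V n * W n)%type : neFinType)|%:R^-1)%:E *
           lne (cov (1 / 2) delta (mu_ n)))%E.
Proof.
move=> /(lw_convP compact_setT) nuP.
have cX : compact [set: X] by exact: compact_setT.
have D n : exists Jpx : {J : finType & ((J -> R) * (J -> config (V n) X))%type},
    let p := (projT2 Jpx).1 in let x := (projT2 Jpx).2 in
    [/\ forall j, 0 <= p j, \sum_j p j = 1,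
      forall b, \sum_(j | cname c (x j) == b) p j = nprob c (nu n) b &
      forall (f : config (V n) X -> R) (e : R), bddm f ->
        (forall y z : config (V n) X,
          (forall v, mdist (y v) (z v) < n.+1%:R^-1) -> `|f y - f z| <= e) ->
        `|\sum_j p j * f (x j) - Ex (nu n) f| <= e].
  have n0 : 0 < n.+1%:R^-1 :> R by rewrite invr_gt0.
  have [I' [c' [mc' cc']]] := fine_label n0.
  have [J [p [x H]]] := discretization (nu n) mc mc' cc'.
  by exists (existT _ J (p, x)).
pose Jpx n := sval (cid (D n)).
have JpxP n := svalP (cid (D n)).
pose J n := projT1 (Jpx n).
pose p n : J n -> R := (projT2 (Jpx n)).1.
pose x n : J n -> config (V n) X := (projT2 (Jpx n)).2.
have p0 n j : 0 <= @p n j by case: (JpxP n) => H _ _ _; exact: H.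
have p1 n : \sum_j @p n j = 1 by case: (JpxP n).
have pname n b : \sum_(j | cname c (@x n j) == b) @p n j = nprob c (nu n) b.
  by case: (JpxP n) => _ _ H _; exact: H.
have papp n (f : config (V n) X -> R) (e : R) : bddm f ->
    (forall y z : config (V n) X,
      (forall v, mdist (y v) (z v) < n.+1%:R^-1) -> `|f y - f z| <= e) ->
    `|\sum_j @p n j * f (@x n j) - Ex (nu n) f| <= e.
  by case: (JpxP n) => _ _ _ H; exact: H.
have xloc f : continuous f -> vanishing (fun n => avg (fun v =>
    `|\sum_j @p n j * f (pullback (s n) v (@x n j)) - Ex mu f|)).
  move=> cf e e0; have e2 : 0 < e / 2 by rewrite divr_gt0.
  have [r r0 rP] := uniform_modulus cf e2.
  have nr : \forall n \near \oo, n.+1%:R^-1 <= r :> R.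
    near=> n; rewrite invf_ple ?posrE//.
    rewrite (@le_trans _ _ n%:R) ?ler_nat//.
    by near: n; exact: nbhs_infty_ger.
  apply: filterS2 nr (nuP f cf _ e2) => n nr dev.
  rewrite [leRHS]splitr; apply: le_trans (lerD (lexx _) dev).
  rewrite -[X in X + _](@avg_cst R (V n)) /local_deviation -avgD.
  apply: le_avg => v; set A := \sum_j _.
  set B := Ex (nu n) _.
  rewrite (_ : A - _ = (A - B) + (B - Ex mu f)); last by rewrite addrA subrK.
  apply: (le_trans (ler_normD _ _)); rewrite lerD2r; apply: papp.
    exact: bddm_pullback.
  move=> y z yz; apply/ltW/rP => g.
  by apply: lt_le_trans nr; exact: yz.
have QP n : exists Q : probability (config (V n * W n) X) R,
    (forall B, Q B = (\sum_(phi : {ffun W n -> J n} |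
      `[< B (assemble (@x n) phi) >]) pweight (@p n) phi)%:E) /\
    (forall f, bddm f -> Ex Q f = \sum_(phi : {ffun W n -> J n})
      pweight (@p n) phi * f (assemble (@x n) phi)).
  apply: finite_support_measure; last exact: sum_pweight.
  by move=> phi; exact: pweight_ge0.
pose Q n := sval (cid (QP n)).
have QB n := (svalP (cid (QP n))).1.
have QE n := (svalP (cid (QP n))).2.
exists Q; split.
  exact: (product_model_lde W_large p0 p1 xloc QE).
move=> kappa k01; have /andP[k0 k1] := k01.
have I0 : 0 < #|I|%:R :> R by exact: lt_le_trans I1.
(* [t] bounds the moment factor [expR (#|I| * t * N)] by [expR (kappa * N)] and
   [eta] does the same for [t ^- k]. *)
pose t : R := kappa / #|I|%:R.
have t0 : 0 < t by rewrite divr_gt0.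
have t1 : t <= 1.
  by rewrite ler_pdivrMr// mul1r (le_trans (ltW k1)).
have t01 : 0 < t <= 1 by rewrite t0.
have It : #|I|%:R * t <= kappa by rewrite /t mulrC divfK ?gt_eqF.
have [eta eta0 eta_t] := small_disagreement_rate k0 t01.
have e16 : 0 < eta / 16 by rewrite divr_gt0.
have [r r0 rP] := gap_bump_small c_null e16.
exists (r * eta / 2); first by rewrite divr_gt0// mulr_gt0.
pose f (y : config G X) : R := gap_bump c r (y 1%g).
have cf : continuous f.
  move=> y; have cv := @Defs.coord_continuous G X 1%g.
  exact: (continuous_comp (cv y) (@continuous_gap_bump R X I c r r0 (y 1%g))).
pose C : R := ln #|I|%:R - ln kappa.
have vC : vanishing (fun n => (kappa^-1 * (kappa / 16)^-1 * C ^+ 2) * #|W n|%:R^-1).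
  apply: vanishingZ => //; rewrite mulr_ge0 ?sqr_ge0// mulr_ge0 ?invr_ge0 ?ltW//.
  by rewrite divr_gt0.
have vl : vanishing (fun n => ln 4 * #|W n|%:R^-1 : R).
  by apply: vanishingZ => //; rewrite ln_ge0// ler1n.
have i16 : 0 < 1 / 16 :> R by rewrite divr_gt0.
near=> n.
have nm b : name_weight (@p n) (fun j => cname c (@x n j)) b = nprob c (nu n) b.
  exact: pname.
rewrite (eq_bigr (fun b => name_weight (@p n) (fun j => cname c (@x n j)) b *
    ln (name_weight (@p n) (fun j => cname c (@x n j)) b))); last first.
  by move=> b _; rewrite nm.
apply: (@product_cov_lower R X (V n) (W n) I (J n) c (@p n) (@x n) (p0 n) (p1 n)
  (Q n) (@QB n) (gap_bump c r) r kappa t eta (gap_bump_ge0 c r) r0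
  (fun y z => @gap_bump_ge1 R X I c r y z r0) k01 t01 eta0 It eta_t).
- rewrite -/C mulrDr [kappa^-1 * (kappa / 16)]mulrA mulVf ?gt_eqF//.
  have : kappa^-1 * (kappa / 16)^-1 * C ^+ 2 * #|W n|%:R^-1 <= 1 / 16.
    by near: n; exact: vC.
  by rewrite !mulrA => /(le_sixteenths (lexx _)).
- rewrite (_ : \sum_j _ = avg (fun v =>
      \sum_j @p n j * f (pullback (s n) v (@x n j)))).
    have dev : avg (fun v => `|\sum_j @p n j * f (pullback (s n) v (@x n j))
        - Ex mu f|) <= eta / 16 by near: n; exact: xloc.
    have := le_trans (ler_norm _) (le_trans (le_norm_avg _) dev).
    by rewrite avgB avg_cst => /le_sixteenths /(_ rP); rewrite subrK.
  transitivity (avg (fun v => \sum_j @p n j * gap_bump c r (@x n j v))).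
    by rewrite avg_sum; apply: eq_bigr => j _; rewrite avgZ.
  (* [s n 1] permutes the vertices, so it disappears from the average. *)
  rewrite /avg; congr (_ * _).
  by rewrite (reindex_inj (@perm_inj _ (s n 1%g))).
- by near: n; exact: vl.
Unshelve. all: end_near. Qed.

End lower_bound.

(** * The equality *)

Lemma le_limn_esup_near (R : realType) (u w : (\bar R)^nat) (e : R) :
  (\forall n \near \oo, (u n <= w n + e%:E)%E) ->
  (limn_esup u <= limn_esup w + e%:E)%E.
Proof.
move=> uw; rewrite -leeBlDr//; apply: le_ereal_inf_tmp => _ [A oA <-].
rewrite leeBlDr//; apply: ge_ereal_inf.
exists (ereal_sup (u @` (A `&` [set n | (u n <= w n + e%:E)%E]))).
  by exists (A `&` [set n | (u n <= w n + e%:E)%E]) => //; exact: filterI.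
apply: ge_ereal_sup => _ [n [An unw] <-]; apply: (le_trans unw).
by rewrite leeD2r//; apply: ereal_sup_ubound; exists n.
Qed.

Lemma cov_le_eps (R : realType) (X : compactMetricType R) (V : neFinType)
    (eps eps' delta : R) (nu : probability (config V X) R) : eps' <= eps ->
  (cov eps delta nu <= cov eps' delta nu)%E.
Proof.
move=> le_eps; apply: le_ereal_inf_tmp => _ [n [ct ctP] <-].
apply: ereal_inf_lbound; exists n => //; exists ct; apply: le_lt_trans ctP.
by rewrite lee_fin lerD2l lerN2.
Qed.

Lemma cov_ge0 (R : realType) (X : compactMetricType R) (V : neFinType)
    (eps delta : R) (nu : probability (config V X) R) :
  (0 <= cov eps delta nu)%E.
Proof. by apply: le_ereal_inf_tmp => _ [n _ <-]; rewrite lee_fin ler0n. Qed.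

Lemma lt_diam_label (R : realType) (X : compactMetricType R) (I : finType)
    (c : X -> I) (r : R) :
  (forall i, (diam (c @^-1` [set i]) < r%:E)%E) ->
  forall x y, c x = c y -> mdist x y < r.
Proof.
move=> cr x y cxy; rewrite -lte_fin; apply: le_lt_trans (cr (c x)).
by apply: ereal_sup_ubound; exists x => //; exists y.
Qed.

Lemma vanishing_card (R : realType) (W : nat -> neFinType) (n_ : nat -> nat) :
  #|W n|%N @[n --> \oo] --> \oo -> {homo n_ : i j / (i < j)%N} ->
  vanishing (fun i => #|W (n_ i)|%:R^-1 : R).
Proof.
move=> /cvgnyPge hW n_inc e e0.
have n_ge i : (i <= n_ i)%N.
  by elim: i => // i /leq_ltn_trans; apply; exact: n_inc.
have [N _ HN] := hW (Num.truncn e^-1).+1.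
exists N => // i /= Ni; rewrite invf_ple ?posrE ?card_gt0R// ltW//.
apply: (lt_le_trans (truncnS_gt _)); rewrite ler_nat.
by apply: HN => /=; exact: leq_trans (n_ge i).
Qed.

Theorem mainTheorem6 (R : realType) (G : countGroupType)
    (V : nat -> neFinType) (sigma : forall n, G -> {perm V n})
    (hsigma : sofic_approximation R sigma)
    (W : nat -> neFinType) (hW : #|W n|%N @[n --> \oo] --> \oo)
    (X : compactMetricType R)
    (mu : probability (config G X) R) (hmu : shift_invariant mu)
    (frakP : set (set (set X)))
    (hP : forall P, frakP P -> finite_borel_partition P)
    (hPi : forall delta : R, 0 < delta ->
       exists2 P, frakP P & forall C, P C -> (diam C < delta%:E)%E)
    (hPii : forall P C, frakP P -> P C ->
       mu [set x | boundary C (x 1%g)] = 0%E) :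
  model_measure_entropy (V := fun n => (V n * W n)%type)
      (fun n => inflate (W := W n) (sigma n)) mu =
  lw_entropy sigma frakP mu.
Proof.
have fine_label (r : R) : 0 < r -> exists2 P, frakP P &
    exists (I : finType) (c : X -> I), [/\ borel_label c,
      (forall i, exists x, c x = i), P = range (fun i => c @^-1` [set i]) &
      forall x y, c x = c y -> mdist x y < r].
  move=> r0; have [P fP Pr] := hPi r r0.
  have [I [c [mc cs PE]]] := partition_label (hP _ fP).
  exists P => //; exists I, c; split => //; apply: lt_diam_label => i.
  by apply: Pr; rewrite PE; exists i.
apply/eqP; rewrite eq_le; apply/andP; split.
(* Covering numbers increase as [eps] decreases, so [eps <= 1 / 2] may be
   assumed. *)
- apply: ge_ereal_sup => _ [n_ [mu_ [n_inc lde ->]]].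
  apply: ge_ereal_sup => _ [delta [eps [delta0 eps0 ->]]].
  have Wv := @vanishing_card R W n_ hW n_inc.
  have [P fP [I [c [mc cs PE cd]]]] := fine_label _ delta0.
  pose eps' : R := Num.min eps (1 / 2).
  have e01 : 0 < eps' < 1.
    by rewrite /eps' lt_min eps0 divr_gt0//= gt_min [1 / 2 < 1]ltr_pdivrMr//
      mul1r ltr1n orbT.
  have /andP[e0 e1] := e01.
  have [nu [lw nuH]] := lde_upper_bound mc cd e01 lde.
  apply: (@le_trans _ _ (limn_esup (fun i =>
      (#|V (n_ i)|%:R^-1 * shannon (nu i) (partition_power P))%:E))); last first.
    by apply: ereal_sup_ubound; exists P, n_, nu.
  apply/lee_addgt0Pr => e e_gt0; apply: le_limn_esup_near.
  have vl : vanishing (fun i => - ln eps' * #|W (n_ i)|%:R^-1 : R).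
    by apply: vanishingZ => //; rewrite oppr_ge0 ln_le0// ltW.
  apply: filterS (vl e e_gt0) => i He.
  have V0 : 0 < #|V (n_ i)|%:R :> R by exact: card_gt0R.
  have W0 : 0 < #|W (n_ i)|%:R :> R by exact: card_gt0R.
  rewrite card_prod natrM.
  set H := shannon _ _.
  have HE : H = - \sum_b nprob c (nu i) b * ln (nprob c (nu i) b).
    by rewrite /H PE shannon_nprob.
  apply: (@le_trans _ _ (((#|V (n_ i)|%:R * #|W (n_ i)|%:R)^-1)%:E *
      (#|W (n_ i)|%:R * H - ln eps')%:E)%E).
    rewrite lee_pmul2l// ?lte_fin ?invr_gt0 ?mulr_gt0//.
    rewrite HE; apply: le_trans (nuH i).
    rewrite lee_lne ?in_itv /= ?leey ?andbT ?cov_ge0//.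
    by apply: cov_le_eps; rewrite ge_min lexx.
  rewrite -EFinM -EFinD lee_fin.
  rewrite [leLHS](_ : _ = #|V (n_ i)|%:R^-1 * H +
      #|V (n_ i)|%:R^-1 * (- ln eps' * #|W (n_ i)|%:R^-1)); last first.
    by field; rewrite !gt_eqF.
  rewrite lerD2l (le_trans _ He)// ler_piMl//.
    by rewrite mulr_ge0 ?invr_ge0// oppr_ge0 ln_le0// ltW.
  by rewrite invf_le1// ler1n card_neFin.
- apply: ge_ereal_sup => _ [P [n_ [nu [fP n_inc lw ->]]]].
  have Wv := @vanishing_card R W n_ hW n_inc.
  have [I [c [mc cs PE]]] := partition_label (hP _ fP).
  have c_null i : mu [set x | boundary (c @^-1` [set i]) (x 1%g)] = 0%E.
    by apply: (hPii _ _ fP); rewrite PE; exists i.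
  have fine_label' (r : R) : 0 < r -> exists (I' : finType) (c' : X -> I'),
      borel_label c' /\ forall x y, c' x = c' y -> mdist x y < r.
    move=> r0; have [_ _ [I' [c' [mc' _ _ cc']]]] := fine_label r r0.
    by exists I', c'.
  have [mu_ [lde mu_cov]] := lde_lower_bound Wv mc c_null fine_label' lw.
  pose S := ereal_sup [set l | exists delta eps : R, [/\ 0 < delta, 0 < eps &
    l = limn_esup (fun i => (#|((V (n_ i) * W (n_ i))%type : neFinType)|%:R^-1)%:E *
      lne (cov eps delta (mu_ i)))%E]].
  apply: (@le_trans _ _ S); last first.
    by apply: ereal_sup_ubound; exists n_, mu_.
  apply/lee_addgt0Pr => e e0.
  pose kappa : R := Num.min (e / 5) (1 / 2).
  have k01 : 0 < kappa < 1.
    rewrite /kappa lt_min !divr_gt0//= gt_min [1 / 2 < 1]ltr_pdivrMr//.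
    by rewrite mul1r ltr1n orbT.
  have ke : 5 * kappa <= e.
    by rewrite mulrC -ler_pdivlMr// /kappa ge_min lexx.
  have [delta delta0 mu_near] := mu_cov kappa k01.
  pose u i := ((#|((V (n_ i) * W (n_ i))%type : neFinType)|%:R^-1)%:E *
      lne (cov (1 / 2) delta (mu_ i)))%E.
  have uS : (limn_esup u <= S)%E.
    by apply: ereal_sup_ubound; exists delta, (1 / 2); split => //; exact: divr_gt0.
  apply: le_trans (leeD2r _ uS).
  apply: le_limn_esup_near; apply: filterS mu_near => i.
  rewrite -/(u i) EFinB leeBlDr// => H.
  rewrite PE shannon_nprob//; apply: (le_trans H).
  by rewrite leeD2l// lee_fin.
Qed.
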